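(* Let $n\ge2$. For any non-negative measurable functions $f,g:\mathbb{R}^n\to[0,\infty)$ and any non-increasing measurable function $\Omega:(0,\infty)\to(0,\infty)$ satisfying $$f(x)g(y)\le\Omega^2([x,y])\qquad\text{for all }x,y\in\mathbb{R}^n\text{ with }[x,y]>0,$$ one has $$\Big(\int_{\mathbb{R}^n}f(x)\,dx\Big)\Big(\int_{\mathbb{R}^n}g(y)\,dy\Big)\le\Big(\int_{\mathbb{R}^n}\Omega(|z|^2)\,dz\Big)^2.$$
   Context: For $x,y\in\mathbb{R}^n\setminus\{o\}$, $[x,y]=|x||y|\sqrt{1-\big\langle\frac{x}{|x|},\frac{y}{|y|}\big\rangle^2}$, and $[x,y]=0$ if $x=o$ or $y=o$. Measurable means Borel measurable; $0\cdot\infty=0$. *)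

(* Defs.v *)
From HB Require Import structures.
From mathcomp Require Import all_boot all_order all_algebra.
From mathcomp Require Import all_classical all_reals all_analysis.
From mathcomp Require Import measurable_realfun.

Set Implicit Arguments.
Unset Strict Implicit.
Unset Printing Implicit Defensive.

Import Order.TTheory GRing.Theory Num.Theory.
Import numFieldNormedType.Exports.

Local Open Scope classical_set_scope.
Local Open Scope ring_scope.

Section euclidean.
Context {R : realType} {n : nat}.
Implicit Types x y : 'rV[R]_n.

Definition dotv x y : R := \sum_(i < n) x 0 i * y 0 i.

(* The library norm on 'rV[R]_n is the sup norm, hence a separate Euclidean
   norm. *)
Definition enorm x : R := Num.sqrt (dotv x x).

(* [x, y]: the product of the norms with the sine of the angle between x and
   y; 0 if one of them vanishes. *)
Definition sine_bracket x y : R :=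
  if (x == 0) || (y == 0) then 0
  else enorm x * enorm y *
       Num.sqrt (1 - dotv ((enorm x)^-1 *: x) ((enorm y)^-1 *: y) ^+ 2).

End euclidean.

Fact rV_borel_display : measure_display.
Proof. exact: default_measure_display. Qed.

HB.instance Definition _ (R : realType) (n : nat) :=
  @isMeasurable.Build rV_borel_display 'rV[R]_n <<s @open 'rV[R]_n >>
    (@sigma_algebra0 _ setT _) (@sigma_algebraC _ _)
    (@sigma_algebra_bigcup _ setT _).

Section rV_measurable.
Context {R : realType} {n : nat}.

Lemma rV_open_measurable (U : set 'rV[R]_n) : open U -> measurable U.
Proof. by move=> oU; apply: sub_sigma_algebra. Qed.

Lemma measurable_coord (i : 'I_n) :
  measurable_fun [set: 'rV[R]_n] (fun x : 'rV[R]_n => x 0 i).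
Proof.
apply: (measurability _ (RGenOpens.measurableE R)).
move=> _ [_ [a [b ->]] <-]; rewrite setTI; apply: rV_open_measurable.
apply: open_comp; last exact: interval_open.
by move=> x _; exact: coord_continuous.
Qed.

Let rbox (q : 'rV[rat]_n * rat) : set 'rV[R]_n :=
  [set x | forall i, `|ratr (q.1 0 i) - x 0 i| < ratr q.2].

Let open_bigcup_rbox (U : set 'rV[R]_n) : open U ->
  U = \bigcup_(q in [set q | rbox q `<=` U]) rbox q.
Proof.
move=> oU; apply/seteqP; split=> [x Ux|x [q /= qU qx]]; last exact: qU.
have /nbhs_ballP[e /= e0 xeU] : nbhs x U by exact: open_nbhs_nbhs.
have e20 : 0 < e / 2 by rewrite divr_gt0.
have [r] := rat_in_itvoo e20; rewrite in_itv/= => /andP[r0 re].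
have qP (i : 'I_n) : exists q : rat, `|ratr q - x 0 i| < ratr r.
  have [|q] := @rat_in_itvoo R (x 0 i - ratr r) (x 0 i + ratr r).
    by rewrite ltrD2l gtrN.
  by rewrite in_itv/= -ltr_distl => qx; exists q.
have [q qE] := choice qP.
exists (\row_i q i, r) => [y qy|i] /=; last by rewrite mxE.
apply: xeU; split=> // i j; rewrite /ball/= ord1.
have := qy j; rewrite /= mxE => qyj.
rewrite -(subrK (ratr (q j)) (x 0 j)) -addrA (le_lt_trans (ler_normD _ _))//.
rewrite (splitr e) ltrD//; last exact: lt_trans re.
by rewrite distrC (lt_trans (qE j)).
Qed.

Lemma measurable_fun_rV d (T : measurableType d) (f : T -> 'rV[R]_n) :
  (forall i, measurable_fun setT (fun t => f t 0 i)) -> measurable_fun setT f.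
Proof.
move=> mf; apply: (@measurability _ _ _ _ setT f (@open 'rV[R]_n)) => //.
move=> _ [U oU <-]; rewrite setTI (open_bigcup_rbox oU) preimage_bigcup.
rewrite bigcup_mkcond; apply: countable_bigcupT_measurable => // q.
case: ifP => // _.
rewrite (_ : _ @^-1` _ = \bigcap_(i in [set: 'I_n])
    ((fun t => f t 0 i) @^-1` ball (ratr (q.1 0 i) : R) (ratr q.2))).
  apply: fin_bigcap_measurable => // i _; rewrite -[X in measurable X]setTI.
  by apply: mf => //; rewrite ball_itv; exact: measurable_itv.
by apply/seteqP; split=> [t qt i _|t qt i]; [exact: qt|exact: (qt i)].
Qed.

End rV_measurable.

Section consv.
Context {R : realType} {n : nat}.

Definition consv (p : R * 'rV[R]_n) : 'rV[R]_n.+1 := row_mx (p.1)%:M p.2.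

Lemma consv0 p : consv p 0 ord0 = p.1.
Proof.
have -> : ord0 = @lshift 1 n ord0 :> 'I_n.+1 by exact/val_inj.
by rewrite [LHS]row_mxEl mxE eqxx.
Qed.

Lemma consvS p i : consv p 0 (lift ord0 i) = p.2 0 i.
Proof.
have -> : lift ord0 i = rshift 1 i :> 'I_n.+1 by exact/val_inj.
by rewrite [LHS]row_mxEr.
Qed.

Lemma measurable_consv : measurable_fun setT consv.
Proof.
apply: measurable_fun_rV => i; case: (unliftP ord0 i) => [j|] ->.
  under eq_fun do rewrite consvS.
  exact: measurableT_comp (measurable_coord j) measurable_snd.
under eq_fun do rewrite consv0.
exact: measurable_fst.
Qed.

Variable mu : {measure set 'rV[R]_n -> \bar R}.

Definition consv_measure : set 'rV[R]_n.+1 -> \bar R :=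
  pushforward (@lebesgue_measure R \x^ mu)%E consv.

HB.instance Definition _ := Measure.copy consv_measure
  (measure_function_pushforward__canonical__measure_function_Measure
    (@lebesgue_measure R \x^ mu)%E measurable_consv).

End consv.

(* Lebesgue measure on the Borel sets of R^n, as the n-fold product of the
   one-dimensional Lebesgue measure. *)
Fixpoint rV_lebesgue (R : realType) (n : nat) :
    {measure set 'rV[R]_n -> \bar R} :=
  match n with
  | 0 => \d_(0 : 'rV[R]_0)
  | m.+1 => consv_measure (rV_lebesgue R m)
  end.

Lemma rV_lebesgue_box (R : realType) (n : nat) (A : 'I_n -> set R) :
  (forall i, measurable (A i)) ->
  rV_lebesgue R n [set x : 'rV[R]_n | forall i, A i (x 0 i)] =
  (\prod_(i < n) lebesgue_measure (A i))%E.
Proof.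
elim: n A => [|n IH] A mA /=.
  rewrite big_ord0 diracE mem_set//; by case.
rewrite big_ord_recl /= /consv_measure /pushforward.
rewrite (_ : _ @^-1` _ = A ord0 `*`
    [set x : 'rV[R]_n | forall i : 'I_n, A (lift ord0 i) (x 0 i)]); last first.
  apply/seteqP; split=> [p /= pA|p /= [p0 pA] i].
    by split=> [|i]; [rewrite -(consv0 p)|rewrite -consvS].
  by case: (unliftP ord0 i) => [j|] ->; rewrite ?consvS ?consv0.
rewrite product_measure2E; [by congr *%E; exact: IH|exact: mA|].
rewrite [X in measurable X](_ : _ = \bigcap_(i in [set: 'I_n])
    ((fun x : 'rV[R]_n => x 0 i) @^-1` A (lift ord0 i))); last first.
  by apply/seteqP; split=> [t qt i _|t qt i]; [exact: qt|exact: (qt i)].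
apply: fin_bigcap_measurable => // i _; rewrite -[X in measurable X]setTI.
by apply: measurable_coord.
Qed.

(* Main.v *)
(* For the vectors x and y, [x, y] is the norm of the exterior product x ^ y,
   so along two parallel lines, s v + x and t v + y, the square of [., .] is a
   convex function of (s, t).  Hence Steiner symmetrization of both sets A and B
   in one direction v preserves an inequality [x, y] <= r on A x B, as well as
   the two volumes.  If A lies in the ball of radius rho while some y in B has
   |y| > r / rho, then A lies in a cylinder with axis y, so its width in some
   direction w0 is smaller than rho; finitely many symmetrizations that reflect
   w0 to the points of a net of the sphere reduce all the widths, and they put
   A in a ball of radius eta rho with eta < 1 independent of A and B.
   Iterating, either vol(A) = 0 or the sets end up in balls of radii rho and
   about r / rho, so vol(A) vol(B) <= r^n vol(ball)^2.  Applied to the superlevel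
   sets {f > e^-u} and {g > e^-v}, this is the hypothesis of the one-dimensional
   Prekopa-Leindler inequality for u |-> e^-u vol{f > e^-u} and its analogues,
   whose integrals are those of f, g and Omega(|z|^2). *)
From HB Require Import structures.
Require Import Defs.
From mathcomp Require Import all_boot all_order all_algebra.
From mathcomp Require Import all_classical all_reals all_analysis.
From mathcomp Require Import measurable_realfun.
From mathcomp Require Import ring lra.

Set Implicit Arguments.
Unset Strict Implicit.
Unset Printing Implicit Defensive.

Import Order.TTheory GRing.Theory Num.Theory.
Import numFieldNormedType.Exports.

Local Open Scope classical_set_scope.
Local Open Scope ring_scope.

(** * Affine maps and shears *)

Section sigma_finite_copy.
Context d (T : measurableType d) (R : realType).
Variables (mu : {measure set T -> \bar R}) (smu : sigma_finite setT mu).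

(* [mu] itself; the proof argument is what the instance below is keyed on *)
Definition sigma_finite_copy of sigma_finite setT mu : set T -> \bar R := mu.

HB.instance Definition _ := Measure.copy (sigma_finite_copy smu) mu.

HB.instance Definition _ :=
  @Measure_isSigmaFinite.Build _ _ _ (sigma_finite_copy smu) smu.

End sigma_finite_copy.

(** Tonelli for an indicator. Sigma-finiteness of [m2] is a hypothesis rather than a structure
    because the recursion in [rV_lebesgue] yields a plain measure. *)
Lemma sigma_finite_fubini_sections d1 d2 (T1 : measurableType d1)
    (T2 : measurableType d2) (R : realType)
    (m1 : {sigma_finite_measure set T1 -> \bar R})
    (m2 : {measure set T2 -> \bar R}) (B : set (T1 * T2)) :
  sigma_finite setT m2 -> measurable B ->
  (\int[m2]_y m1 (ysection B y) = \int[m1]_x m2 (xsection B x))%E.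
Proof.
move=> sm2 mB.
pose m2' : {sigma_finite_measure set T2 -> \bar R} :=
  sigma_finite_copy sm2.
have := indic_fubini_tonelli m1 m2' mB.
by rewrite indic_fubini_tonelli_FE// indic_fubini_tonelli_GE.
Qed.

Section lebesgue_rV.
Context {R : realType}.
Local Notation lam := (@lebesgue_measure R).

Lemma measurable_affine (k a : R) :
  measurable_fun [set: R] (fun s : R => k * s + a).
Proof.
apply: measurable_funD => //; apply: measurable_funM => //.
Qed.

(** Lebesgue measure is determined by its values on half-open intervals, and there it agrees with
    [k] times its pushforward under the affine map. *)
Lemma lebesgue_measure_affine (k a : R) (A : set R) : 0 < k -> measurable A ->
  (lam ((fun s => (k * s + a)%R) @^-1` A) = (k^-1)%:E * lam A)%E.
Proof.
move=> k0 mA.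
have ki0 : 0 <= k^-1 by rewrite invr_ge0 ltW.
have k'0 : 0 <= k by rewrite ltW.
have mf : measurable_fun [set: measurableTypeR R]
    ((fun s : R => k * s + a) : R -> measurableTypeR R).
  exact: measurable_affine.
pose nu : {measure set (measurableTypeR R) -> \bar R} := mscale (NngNum k'0)
  (measure_function_pushforward__canonical__measure_function_Measure lam
     mf).
have H : lam A = nu A.
  refine (@lebesgue_measure_unique R nu _ A mA) => _ [[c d]] _ <-.
  change (lam `]c, d] = k%:E * lam ((fun s => (k * s + a)%R) @^-1` `]c, d]))%E.
  rewrite (_ : _ @^-1` _ = `](c - a) / k, (d - a) / k]%classic); last first.
    apply/seteqP; split => x /=;
      by rewrite !in_itv /= ler_pdivlMr ?ltr_pdivrMr// lerBrDr ltrBlDr mulrC.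
  rewrite /= !lebesgue_measure_itv /= !lte_fin ltr_pM2r ?invr_gt0// ltrD2r.
  case: ifPn => // _; rewrite ?mule0// -!EFinB -EFinM; congr EFin; field.
  by rewrite gt_eqF.
rewrite H; change (nu A) with (k%:E * lam ((fun s => (k * s + a)%R) @^-1` A))%E.
by rewrite muleA -EFinM mulVf ?mul1e// gt_eqF.
Qed.

Lemma rV_lebesgueS n (E : set 'rV[R]_n.+1) :
  rV_lebesgue R n.+1 E =
  (\int[rV_lebesgue R n]_z lam [set s | E (consv (s, z))])%E.
Proof.
rewrite /= /consv_measure /pushforward /product_measure2 /=.
apply: eq_integral => z _; congr (lam _).
by apply/seteqP; split => s; rewrite /ysection /= inE.
Qed.

Lemma rV_lebesgue_sigma_finite n : sigma_finite [set: 'rV[R]_n] (rV_lebesgue R n).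
Proof.
exists (fun k => [set x : 'rV[R]_n | forall i, `[-(k%:R), k%:R]%classic (x 0 i)]).
  apply/seteqP; split => // x _.
  have [k kP] : exists k : nat, forall i, `|x 0 i| <= k%:R.
    exists (\sum_i Num.truncn `|(x 0 i)%R|%R).+1 => i.
    apply: ltW; apply: (lt_le_trans (truncnS_gt _)).
    by rewrite ler_nat ltnS (bigD1 i) //= leq_addr.
  by exists k => // i; rewrite /= in_itv /= -ler_norml.
move=> k; split.
  rewrite (_ : mkset _ = \bigcap_(i in [set: 'I_n])
      ((fun x : 'rV[R]_n => x 0 i) @^-1` `[-(k%:R), k%:R]%classic)); last first.
    by apply/seteqP; split=> [t qt i _|t qt i]; [exact: qt|exact: (qt i)].
  apply: fin_bigcap_measurable => // i _; rewrite -[X in measurable X]setTI.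
  exact: measurable_coord.
rewrite (@rV_lebesgue_box R n (fun=> `[-(k%:R), k%:R]%classic))//.
elim/big_rec: _ => [|i x _ x_fin]; first by rewrite ltry.
rewrite lebesgue_measure_itv /= lte_fin; case: ifPn => _; last by rewrite mul0e.
by rewrite -EFinB lte_mul_pinfty// lee_fin; rewrite opprK addr_ge0.
Qed.

Lemma measurable_affine_rV n (k : R) (a : 'rV[R]_n) :
  measurable_fun [set: 'rV[R]_n] (fun x : 'rV[R]_n => k *: x + a).
Proof.
apply: measurable_fun_rV => i; under eq_fun do rewrite !mxE.
apply: measurable_funD => //; apply: measurable_funM => //.
exact: measurable_coord.
Qed.

Lemma consv_affine n (k s : R) (z : 'rV[R]_n) (a : 'rV[R]_n.+1) :
  k *: consv (s, z) + a =
  consv (k * s + a 0 ord0, k *: z + \row_i a 0 (lift ord0 i)).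
Proof.
apply/rowP => i; case: (unliftP ord0 i) => [j|] ->.
  by rewrite mxE [X in X + _]mxE !consvS /= !mxE.
by rewrite mxE [X in X + _]mxE !consv0.
Qed.

Lemma measurable_section_consv n (E : set 'rV[R]_n.+1) (z : 'rV[R]_n) :
  measurable E -> measurable [set s : R | E (consv (s, z))].
Proof.
move=> mE; rewrite -[X in measurable X]setTI.
apply: (measurableT_comp (measurable_consv : measurable_fun setT _)) => //.
Qed.

Lemma measurable_fun_section_consv n (E : set 'rV[R]_n.+1) : measurable E ->
  measurable_fun setT (fun z : 'rV[R]_n => lam [set s | E (consv (s, z))]).
Proof.
move=> mE.
have mE' : measurable (consv @^-1` E : set (R * 'rV[R]_n)).
  by rewrite -[X in measurable X]setTI; exact: measurable_consv.
have := measurable_fun_ysection lam mE'.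
apply: eq_measurable_fun => z _; congr (lam _).
by apply/seteqP; split => s; rewrite /ysection /= inE.
Qed.

(** Induction on the dimension: the first coordinate contributes one factor [k^-1] by the
    one-dimensional case, the remaining ones contribute [k^-1 ^+ n]. *)
Lemma rV_lebesgue_affine n (k : R) (a : 'rV[R]_n) (E : set 'rV[R]_n) :
  0 < k -> measurable E ->
  (rV_lebesgue R n ((fun x => (k *: x + a)%R) @^-1` E) =
   (k^-1 ^+ n)%:E * rV_lebesgue R n E)%E.
Proof.
move=> k0; elim: n a E => [|n IH] a E mE.
  by rewrite expr0 mul1e; congr (_ _); apply/seteqP; split => x /=;
    rewrite (_ : _ + a = x)//; apply/rowP; case.
have ki0 : 0 <= k^-1 by rewrite invr_ge0 ltW.
have kn0 : 0 <= k^-1 ^+ n by rewrite exprn_ge0.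
rewrite !rV_lebesgueS.
set a' := \row_i a 0 (lift ord0 i).
pose phi z := lam [set s | E (consv (s, z))].
transitivity (\int[rV_lebesgue R n]_z (k^-1%:E * phi (k *: z + a')%R))%E.
  apply: eq_integral => z _; 
    rewrite -(lebesgue_measure_affine (a 0 ord0) k0)//; last first.
    exact: measurable_section_consv.
  by congr (lam _); apply/seteqP; split => s /=; rewrite consv_affine.
have mphi : measurable_fun setT phi by exact: measurable_fun_section_consv.
rewrite ge0_integralZl//; last first.
  exact: (measurableT_comp mphi (measurable_affine_rV k a')).
rewrite exprS EFinM -muleA; congr (_ * _)%E.
transitivity (\int[mscale (NngNum kn0) (rV_lebesgue R n)]_z phi z)%E; last first.
  by rewrite ge0_integral_mscale//= => x _; exact: measure_ge0.
have mf := measurable_affine_rV k a'.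
transitivity (\int[pushforward (rV_lebesgue R n) (fun x => k *: x + a')%R]_z phi z)%E.
  by rewrite (ge0_integral_pushforward mf)// => y _; exact: measure_ge0.
(* The induction hypothesis, read for all measurable sets, says that the pushforward is a multiple
   of the measure; hence so are the integrals of [phi]. *)
refine (@eq_measure_integral _ _ _ setT
  (mscale (NngNum kn0) (rV_lebesgue R n))
  (measure_function_pushforward__canonical__measure_function_Measure
     (rV_lebesgue R n) mf) phi _).
by move=> A mA _; exact: IH.
Qed.

(** Volume as an integral over lines of direction (1, v). After exchanging the order of integration,
    the shear only translates each slice at fixed [s]. *)
Lemma rV_lebesgueS_shear n (v : 'rV[R]_n) (E : set 'rV[R]_n.+1) : measurable E ->
  rV_lebesgue R n.+1 E =
  (\int[rV_lebesgue R n]_z lam [set s | E (consv (s, z + s *: v)%R)])%E.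
Proof.
move=> mE.
pose shear (p : R * 'rV[R]_n) := consv (p.1, p.2 + p.1 *: v).
have mcv : measurable_fun setT shear.
  apply: measurable_fun_rV => i; case: (unliftP ord0 i) => [j|] ->.
    under eq_fun do rewrite /shear consvS /= !mxE.
    apply: measurable_funD; last exact: measurable_funM.
    exact: measurableT_comp (measurable_coord j) measurable_snd.
  under eq_fun do rewrite /shear consv0.
  exact: measurable_fst.
have mE1 : measurable (shear @^-1` E).
  by rewrite -[X in measurable X]setTI; exact: mcv.
have mE2 : measurable (consv @^-1` E : set (R * 'rV[R]_n)).
  by rewrite -[X in measurable X]setTI; exact: measurable_consv.
pose mu := rV_lebesgue R n.
rewrite rV_lebesgueS.
transitivity (\int[mu]_z lam (ysection (consv @^-1` E) z))%E.
  apply: eq_integral => z _; congr (lam _).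
  by apply/seteqP; split => s; rewrite /ysection /= inE.
transitivity (\int[mu]_z
    lam (ysection (shear @^-1` E) z))%E; last first.
  apply: eq_integral => z _; congr (lam _).
  by apply/seteqP; split => s; rewrite /ysection /= inE.
rewrite !(@sigma_finite_fubini_sections _ _ _ _ _ _ mu)//; last 2 first.
  exact: rV_lebesgue_sigma_finite.
  exact: rV_lebesgue_sigma_finite.
 apply: eq_integral => s _.
have mX : measurable (xsection (consv @^-1` E) s) by exact: measurable_xsection.
have := rV_lebesgue_affine (s *: v) ltr01 mX.
rewrite invr1 expr1n mul1e => <-; congr (rV_lebesgue R n _).
by apply/seteqP; split => z; rewrite /xsection /= !inE /= scale1r.
Qed.

End lebesgue_rV.

(** * Steiner symmetrization *)

Section dotv.
Context {R : realType} {n : nat}.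
Implicit Types x y z : 'rV[R]_n.

Lemma dotvC x y : dotv x y = dotv y x.
Proof. by apply: eq_bigr => i _; rewrite mulrC. Qed.

Lemma dotvDl x y z : dotv (x + y) z = dotv x z + dotv y z.
Proof. by rewrite -big_split; apply: eq_bigr => i _; rewrite mxE mulrDl. Qed.

Lemma dotvZl k x y : dotv (k *: x) y = k * dotv x y.
Proof. by rewrite mulr_sumr; apply: eq_bigr => i _; rewrite mxE mulrA. Qed.

Lemma dotvDr x y z : dotv z (x + y) = dotv z x + dotv z y.
Proof. by rewrite dotvC dotvDl !(dotvC _ z). Qed.

Lemma dotvZr k x y : dotv x (k *: y) = k * dotv x y.
Proof. by rewrite dotvC dotvZl dotvC. Qed.

Lemma dotvNl x y : dotv (- x) y = - dotv x y.
Proof. by rewrite -scaleN1r dotvZl mulN1r. Qed.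

Lemma dotvNr x y : dotv x (- y) = - dotv x y.
Proof. by rewrite dotvC dotvNl dotvC. Qed.

Definition dotvE := (dotvDl, dotvDr, dotvNl, dotvNr, dotvZl, dotvZr).

Lemma dotv_ge0 x : 0 <= dotv x x.
Proof. by apply: sumr_ge0 => i _; rewrite -expr2 sqr_ge0. Qed.

Lemma dotv_eq0 x : (dotv x x == 0) = (x == 0).
Proof.
apply/eqP/eqP => [/eqP|->]; last by apply: big1 => i _; rewrite mxE mul0r.
rewrite psumr_eq0 => [/allP x0|i _]; last by rewrite -expr2 sqr_ge0.
apply/rowP => i; rewrite mxE; apply/eqP.
by have := x0 i (mem_index_enum i); rewrite mulf_eq0 orbb.
Qed.

Lemma dotv_gt0 x : (0 < dotv x x) = (x != 0).
Proof. by rewrite lt_neqAle dotv_ge0 andbT eq_sym dotv_eq0. Qed.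

Lemma dotv0l x : dotv 0 x = 0.
Proof. by apply: big1 => i _; rewrite mxE mul0r. Qed.

Lemma cauchy_schwarz_dotv x y : dotv x y ^+ 2 <= dotv x x * dotv y y.
Proof.
have [->|y0] := eqVneq y 0; first by rewrite dotvC !dotv0l mulr0 expr0n.
have yy : 0 < dotv y y by rewrite dotv_gt0.
have := dotv_ge0 (x - (dotv x y / dotv y y) *: y).
rewrite !dotvE (dotvC y x).
set a := dotv x x; set b := dotv x y; set c := dotv y y in yy *.
rewrite (_ : _ + _ = (a * c - b ^+ 2) / c); last by field; rewrite gt_eqF.
by rewrite pmulr_lge0 ?invr_gt0// subr_ge0.
Qed.

(* Lagrange: [wedge2 x y] is the squared norm of the exterior product x ^ y. *)
Definition wedge2 x y : R := dotv x x * dotv y y - dotv x y ^+ 2.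

Lemma wedge2_ge0 x y : 0 <= wedge2 x y.
Proof. by rewrite subr_ge0 cauchy_schwarz_dotv. Qed.

Lemma sine_bracket_ge0 x y : 0 <= sine_bracket x y.
Proof.
by rewrite /sine_bracket; case: ifP => // _; rewrite !mulr_ge0 ?sqrtr_ge0.
Qed.

Lemma sqr_enorm x : enorm x ^+ 2 = dotv x x.
Proof. by rewrite sqr_sqrtr// dotv_ge0. Qed.

Lemma enorm_ge0 x : 0 <= enorm x.
Proof. exact: sqrtr_ge0. Qed.

Lemma enorm_gt0 x : (0 < enorm x) = (x != 0).
Proof. by rewrite sqrtr_gt0 dotv_gt0. Qed.

Lemma sine_bracketE x y : sine_bracket x y = Num.sqrt (wedge2 x y).
Proof.
rewrite /sine_bracket /wedge2; case: ifPn => [/orP[]/eqP->|].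
- by rewrite !dotv0l mul0r expr0n subrr sqrtr0.
- by rewrite (dotvC x) !dotv0l mulr0 expr0n subrr sqrtr0.
rewrite negb_or -!enorm_gt0 => /andP[x0 y0].
apply/eqP; rewrite -(@eqrXn2 _ 2) ?mulr_ge0 ?sqrtr_ge0//; apply/eqP.
have e : (enorm x * enorm y) ^+ 2 *
   (1 - dotv ((enorm x)^-1 *: x) ((enorm y)^-1 *: y) ^+ 2) = wedge2 x y.
  rewrite /wedge2 -!sqr_enorm !dotvE; field.
  by rewrite !gt_eqF.
rewrite exprMn !sqr_sqrtr ?e ?wedge2_ge0//.
by rewrite -(@pmulr_rge0 _ ((enorm x * enorm y) ^+ 2)) ?e ?wedge2_ge0//
  exprn_gt0 ?mulr_gt0.
Qed.

Lemma sine_bracket_le x y r : 0 <= r ->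
  (sine_bracket x y <= r) = (wedge2 x y <= r ^+ 2).
Proof.
move=> r0; rewrite sine_bracketE -ler_sqr ?nnegrE ?sqrtr_ge0//.
by rewrite sqr_sqrtr ?wedge2_ge0.
Qed.

End dotv.

Section steiner.
Context {R : realType} {n : nat}.
Local Notation lam := (@lebesgue_measure R).
Implicit Types (x y v w : 'rV[R]_n) (A B : set 'rV[R]_n).

(** Otherwise [B] would lie in the interval from [sup B - t] to [sup B]. *)
Lemma lebesgue_measure_gt_diam (B : set R) (t : R) : 0 <= t -> measurable B ->
  (t%:E < lam B)%E -> exists s1 s2, [/\ B s1, B s2 & t <= s1 - s2].
Proof.
move=> t0 mB tB; apply: contrapT => nB.
have Bt s1 s2 : B s1 -> B s2 -> s1 <= s2 + t.
  move=> B1 B2; rewrite leNgt; apply/negP => ts; apply: nB; exists s1, s2.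
  by split=> //; rewrite lerBrDl ltW.
have [B0|/set0P[b Bb]] := eqVneq B set0.
  by move: tB; rewrite B0 measure0 lte_fin ltNge t0.
have hB : has_sup B by split; [exists b|exists (b + t) => s Bs; exact: Bt].
have BM : B `<=` `[sup B - t, sup B]%classic.
  move=> s Bs; rewrite /= in_itv /= sup_upper_bound// andbT lerBlDr.
  by apply: ge_sup => //; [exists b|move=> s1 Bs1; exact: Bt].
pose I := `[sup B - t, sup B]%classic.
have L : (lam I <= t%:E)%E.
  rewrite lebesgue_measure_itv /= lte_fin; case: ifPn => _; last by rewrite lee_fin.
  by rewrite -EFinB lee_fin; lra.
suff : (lam B <= t%:E)%E by rewrite leNgt tB.
apply: le_trans L; apply: le_measure => //; rewrite inE//.
exact: measurable_itv.
Qed.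

(** The length is measured in the parameter [s], that is in units of [v], in which [x] has the
    coordinate [dotv x v / dotv v v]. *)
Definition chord v A x : \bar R := lam [set s | A (x + s *: v)].

(* Each section of [A] by a line parallel to [v] is replaced by the open segment
   of the same length centred on the hyperplane orthogonal to [v]. *)
Definition steiner v A : set 'rV[R]_n :=
  [set x | ((2 * `|dotv x v| / dotv v v)%:E < chord v A x)%E].

Lemma measurable_line v A : measurable A ->
  measurable [set p : 'rV[R]_n * R | A (p.1 + p.2 *: v)].
Proof.
move=> mA.
have mf : measurable_fun setT (fun p : 'rV[R]_n * R => p.1 + p.2 *: v).
  apply: measurable_fun_rV => i; under eq_fun do rewrite !mxE.
  apply: measurable_funD; last exact: measurable_funM.
  exact: measurableT_comp (measurable_coord i) measurable_fst.
by rewrite -[X in measurable X]setTI; exact: mf.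
Qed.

Lemma measurable_chord v A : measurable A -> measurable_fun setT (chord v A).
Proof.
move=> /(measurable_line v) mA; have := measurable_fun_xsection lam mA.
apply: eq_measurable_fun => x _; congr (lam _).
by apply/seteqP; split => s; rewrite /xsection /= inE.
Qed.

Lemma measurable_dotv v : measurable_fun setT (fun x => dotv x v).
Proof.
by apply: measurable_sum => i; apply: measurable_funM => //; exact: measurable_coord.
Qed.

Lemma measurable_steiner v A : measurable A -> measurable (steiner v A).
Proof.
move=> mA; rewrite /steiner -[X in measurable X]setTI.
apply: measurable_lte => //; last exact: measurable_chord.
apply/measurable_EFinP; apply: measurable_funM => //; apply: measurable_funM => //.
by apply: measurableT_comp => //; exact: measurable_dotv.
Qed.

Lemma measurable_line_section v A x : measurable A ->
  measurable [set s | A (x + s *: v)].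
Proof.
move=> /(measurable_line v) /(measurable_xsection x).
by congr measurable; apply/seteqP; split => s; rewrite /xsection /= inE.
Qed.

Lemma chord_shift v A x s : measurable A -> chord v A (x + s *: v) = chord v A x.
Proof.
move=> mA; have := lebesgue_measure_affine s ltr01 (measurable_line_section v x mA).
rewrite invr1 mul1e /chord => <-; congr (lam _); apply/seteqP; split => t /=;
  by rewrite mul1r scalerDl -addrA (addrC (s *: v)).
Qed.

(** The chord is constant along a line, so the section of the symmetrized set is an interval centred
    at [- c] of that length, or the whole line if the chord is infinite. *)
Lemma chord_steiner v A x : v != 0 -> measurable A ->
  chord v (steiner v A) x = chord v A x.
Proof.
move=> v0 mA; have vv : 0 < dotv v v by rewrite dotv_gt0.
rewrite /chord -/(chord v A x).
set c := dotv x v / dotv v v.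
rewrite (_ : mkset _ = [set s | ((2 * `|s + c|)%:E < chord v A x)%E]); last first.
  apply/seteqP; split => s; rewrite /steiner /= chord_shift// => + /=;
  by rewrite (_ : 2 * `|dotv (x + s *: v) v| / dotv v v = 2 * `|s + c|)//;
    rewrite !dotvE -mulrA -{2}(gtr0_norm vv) -normfV -normrM /c;
    congr (2 * `|_|); field; rewrite gt_eqF.
have : (0 <= chord v A x)%E by exact: measure_ge0.
case: (chord v A x) => [m||] // m0.
- rewrite lee_fin in m0.
  rewrite (_ : mkset _ = `](- c - m / 2), (- c + m / 2)[%classic).
    rewrite lebesgue_measure_itv /= lte_fin; case: ifPn => h.
      by rewrite -EFinB; congr EFin; lra.
    by congr EFin; lra.
  apply/seteqP; split => s /=; rewrite in_itv /= lte_fin -ltr_pdivlMl//.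
    by rewrite ltr_norml => /andP[? ?]; apply/andP; split; lra.
  by move=> /andP[? ?]; rewrite ltr_norml; apply/andP; split; lra.
- rewrite (_ : mkset _ = `]-oo, +oo[%classic) ?lebesgue_measure_itv//.
  by apply/seteqP; split => s /= _; rewrite ?in_itv ?ltry.
Qed.

(** All that the estimates below use of the symmetrization: on the line through a new point there
    are two points of [A] at parameter distance at least [2 * |s|], where [s] is the height of the
    new point above the hyperplane orthogonal to [v]. *)
Lemma in_steiner v A x : v != 0 -> measurable A -> steiner v A x ->
  exists x' s s1 s2, [/\ x = x' + s *: v, dotv x' v = 0,
    A (x' + s1 *: v), A (x' + s2 *: v) & 2 * `|s| <= s1 - s2].
Proof.
move=> v0 mA xA; have vv : 0 < dotv v v by rewrite dotv_gt0.
have [||s1 [s2 [A1 A2 s12]]] := lebesgue_measure_gt_diam _ _ xA.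
- by rewrite !mulr_ge0// invr_ge0 ltW.
- exact: measurable_line_section.
pose s := dotv x v / dotv v v.
exists (x - s *: v), s, (s + s1), (s + s2); split.
- by rewrite subrK.
- by rewrite !dotvE /s; field; rewrite gt_eqF.
- by rewrite scalerDl addrA subrK.
- by rewrite scalerDl addrA subrK.
- rewrite opprD addrACA subrr add0r (le_trans _ s12)//.
  by rewrite /s normrM normfV (gtr0_norm vv) mulrA.
Qed.

(** One of the heights [s1], [s2] is at least [|s|] in absolute value, and the squared norm is the
    constant [dotv x' x'] plus the squared height times [dotv v v]. *)
Lemma steiner_ball v A r : v != 0 -> measurable A ->
  (forall x, A x -> dotv x x <= r) -> forall x, steiner v A x -> dotv x x <= r.
Proof.
move=> v0 mA Ar x /(in_steiner v0 mA)[x' [s [s1 [s2 [-> x'v /Ar + /Ar + s12]]]]].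
have vv : 0 < dotv v v by rewrite dotv_gt0.
have E p : dotv (x' + p *: v) (x' + p *: v) = dotv x' x' + p ^+ 2 * dotv v v.
  by rewrite !dotvE (dotvC v) x'v; ring.
rewrite !E => h1 h2.
have : s ^+ 2 <= Num.max (s1 ^+ 2) (s2 ^+ 2).
  rewrite le_max; apply/orP.
  have [h|h] := leP (s ^+ 2) (s1 ^+ 2); [by left|right].
  have : `|s1| < `|s| by rewrite -ltr_sqr ?nnegrE// !real_normK ?num_real.
  rewrite -(real_normK (num_real s)) -(real_normK (num_real s2)) => h3.
  rewrite ler_sqr ?nnegrE//.
  by have := ler_norm s1; have := ler_norm (- s2); rewrite normrN; lra.
rewrite le_max => /orP[] h.
  by apply: le_trans h1; rewrite lerD2l ler_pM2r.
by apply: le_trans h2; rewrite lerD2l ler_pM2r.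
Qed.

Definition reflv v w : 'rV[R]_n := w - (2 * dotv w v / dotv v v) *: v.

(** Reflecting [w] changes the sign of the part of the product along [v]. With [a], [q], [p1], [p2]
    as in the proof and p1 >= p2, a + |q| is at most the mean of a + p1, bounded by [h1], and a -
    p2, bounded by [h2]; the other cases are similar. *)
Lemma steiner_width v A w h1 h2 : v != 0 -> measurable A ->
  (forall x, A x -> `|dotv x w| <= h1) ->
  (forall x, A x -> `|dotv x (reflv v w)| <= h2) ->
  forall x, steiner v A x -> `|dotv x w| <= (h1 + h2) / 2.
Proof.
move=> v0 mA A1 A2 x /(in_steiner v0 mA)[x' [s [s1 [s2 [-> x'v a1 a2 s12]]]]].
have vv : 0 < dotv v v by rewrite dotv_gt0.
have {A1 A2}:= (A1 _ a1, A1 _ a2, A2 _ a1, A2 _ a2).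
have E1 p : dotv (x' + p *: v) w = dotv x' w + p * dotv v w by rewrite !dotvE.
have E2 p : dotv (x' + p *: v) (reflv v w) = dotv x' w - p * dotv v w.
  by rewrite /reflv !dotvE x'v (dotvC w v); field; rewrite gt_eqF.
rewrite !E1 !E2; set a := dotv x' w; set b := dotv v w.
have sb : 2 * `|s * b| <= `|s1 * b - s2 * b|.
  rewrite normrM mulrA -mulrBl normrM ler_wpM2r//.
  by rewrite (le_trans s12)// ler_norm.
move: sb; set q := s * b; set p1 := s1 * b; set p2 := s2 * b.
move=> sb [[[]]].
rewrite !ler_norml => /andP[? ?] /andP[? ?] /andP[? ?] /andP[? ?].
have := ler_norm q; have := ler_norm (- q); rewrite normrN.
by move: sb; case: (ger0P (p1 - p2)) => ? ? ? ?; apply/andP; split; lra.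
Qed.

(** Along the two lines [wedge2] is a constant plus a multiple of a positive semidefinite quadratic
    form [phi]. By the parallelogram law, the value of [phi] at the half-differences [S], [T] is at
    most the mean of its values at two opposite corners, and it controls [phi s t]. *)
Lemma steiner_wedge2 v A B r : v != 0 -> measurable A -> measurable B ->
  (forall x y, A x -> B y -> wedge2 x y <= r) ->
  forall x y, steiner v A x -> steiner v B y -> wedge2 x y <= r.
Proof.
move=> v0 mA mB AB x y /(in_steiner v0 mA)[x' [s [s1 [s2 [-> x'v a1 a2 s12]]]]].
move=> /(in_steiner v0 mB)[y' [t [t1 [t2 [-> y'v b1 b2 t12]]]]].
have vv : 0 < dotv v v by rewrite dotv_gt0.
have {AB} := (AB _ _ a1 b1, AB _ _ a2 b2, AB _ _ a1 b2, AB _ _ a2 b1).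
have E (p q : R) : wedge2 (x' + p *: v) (y' + q *: v) =
    wedge2 x' y' + dotv v v * (p ^+ 2 * dotv y' y' + q ^+ 2 * dotv x' x'
      - 2 * p * q * dotv x' y').
  by rewrite /wedge2 !dotvE !(dotvC v) x'v y'v; ring.
rewrite !E.
have X0 := dotv_ge0 x'; have Y0 := dotv_ge0 y'.
have phi0 (p q : R) : 0 <= p ^+ 2 * dotv y' y' + q ^+ 2 * dotv x' x'
    - 2 * p * q * dotv x' y'.
  have := dotv_ge0 (p *: y' - q *: x'); rewrite !dotvE (dotvC y' x').
  by congr (0 <= _); ring.
move: X0 Y0 phi0; set X := dotv x' x'; set Y := dotv y' y'; set Z := dotv x' y'.
set K := wedge2 x' y'; set c := dotv v v in vv *.
pose phi p q := p ^+ 2 * Y + q ^+ 2 * X - 2 * p * q * Z.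
move=> X0 Y0 phi0; rewrite -!/(phi _ _) => -[[[h11 h22] h12] h21].
pose S := (s1 - s2) / 2; pose T := (t1 - t2) / 2.
have sS : `|s| <= S by rewrite /S; lra.
have tT : `|t| <= T by rewrite /T; lra.
have sS2 : s ^+ 2 <= S ^+ 2.
  by rewrite -(real_normK (num_real s)) ler_sqr ?nnegrE// (le_trans _ sS).
have tT2 : t ^+ 2 <= T ^+ 2.
  by rewrite -(real_normK (num_real t)) ler_sqr ?nnegrE// (le_trans _ tT).
have stST : `|s * t| <= S * T by rewrite normrM ler_pM.
have phist : phi s t <= S ^+ 2 * Y + T ^+ 2 * X + 2 * (S * T) * `|Z|.
  rewrite /phi lerD//; first by rewrite lerD// ler_wpM2r.
  have : - (s * t * Z) <= S * T * `|Z|.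
    by rewrite (le_trans (ler_norm _))// normrN normrM ler_wpM2r.
  lra.
have fin p q : phi s t <= (p + q) / 2 -> K + c * p <= r -> K + c * q <= r ->
    K + c * phi s t <= r.
  rewrite -(ler_pM2l vv) mulrA mulrDr => h1 h2 h3; lra.
(* The sign of [Z] decides which diagonal of corners realizes the bound [phist]: half-differences of
   opposite signs if [Z] is non-negative, of equal signs otherwise. *)
have [Z0|Z0] := ger0P Z.
  apply: fin h12 h21; rewrite (le_trans phist)// (ger0_norm Z0).
  have := phi0 ((s1 + s2) / 2) ((t1 + t2) / 2); rewrite /phi /S /T; lra.
apply: fin h11 h22; rewrite (le_trans phist)// (ltr0_norm Z0).
have := phi0 ((s1 + s2) / 2) ((t1 + t2) / 2); rewrite /phi /S /T; lra.
Qed.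

End steiner.

(** The normalization of [v] makes the first coordinate the parameter along the lines, so the slices
    in [rV_lebesgueS_shear] are exactly the chords, which symmetrization preserves. *)
Lemma steiner_measure (R : realType) n (v : 'rV[R]_n.+1) (A : set 'rV[R]_n.+1) :
  v 0 ord0 = 1 -> measurable A ->
  rV_lebesgue R n.+1 (steiner v A) = rV_lebesgue R n.+1 A.
Proof.
move=> v1 mA.
have v0 : v != 0 by apply/eqP => v0; move: v1; rewrite v0 mxE; lra.
have E (z : 'rV[R]_n) s : consv (s, z + s *: \row_i v 0 (lift ord0 i)) =
    consv (0, z) + s *: v.
  apply/rowP => i; case: (unliftP ord0 i) => [j|] ->.
    by rewrite consvS /= [in RHS]mxE consvS /= !mxE.
  by rewrite consv0 /= [in RHS]mxE consv0 /= !mxE v1 mulr1 add0r.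
rewrite !(rV_lebesgueS_shear (\row_i v 0 (lift ord0 i)))//; last first.
  exact: measurable_steiner.
apply: eq_integral => z _.
transitivity (chord v (steiner v A) (consv (0, z))).
  by congr (lebesgue_measure _); apply/seteqP; split => s /=; rewrite E.
rewrite chord_steiner//.
by congr (lebesgue_measure _); apply/seteqP; split => s /=; rewrite E.
Qed.

(** * Reflections and finite nets of the sphere *)

Section reflection.
Context {R : realType} {n : nat}.
Implicit Types (a b u v w x y : 'rV[R]_n).

Lemma normr_dotv_le x y (a b : R) : 0 <= a -> 0 <= b ->
  dotv x x <= a ^+ 2 -> dotv y y <= b ^+ 2 -> `|dotv x y| <= a * b.
Proof.
move=> a0 b0 xa yb; rewrite -ler_sqr ?nnegrE ?mulr_ge0//.
rewrite real_normK ?num_real// exprMn (le_trans (cauchy_schwarz_dotv x y))//.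
by rewrite ler_pM ?dotv_ge0.
Qed.

Lemma reflvB v a b : reflv v (a - b) = reflv v a - reflv v b.
Proof.
by apply/rowP => i; rewrite !mxE !dotvE; ring.
Qed.

Lemma dotv_reflv v w : v != 0 -> dotv (reflv v w) (reflv v w) = dotv w w.
Proof.
rewrite -dotv_gt0 => vv; rewrite /reflv !dotvE (dotvC v w); field.
by rewrite gt_eqF.
Qed.

(** The factor [k] leaves the reflection unchanged and serves to give its direction the first
    coordinate 1 that [steiner_measure] asks for. *)
Lemma reflv_swap k a b : k != 0 -> dotv a a = dotv b b -> a != b ->
  reflv (k *: (a - b)) a = b.
Proof.
move=> k0 ab; rewrite -subr_eq0 -dotv_gt0 => /gt_eqF.
rewrite /reflv !dotvE (dotvC b a) -ab => ab0.
rewrite scalerA (_ : _ * k = 1); first by rewrite scale1r opprB addrC subrK.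
move: ab0; set p := dotv a a; set q := dotv a b => ab0; field.
rewrite k0 andbT -mulrBr mulf_neq0//.
by apply/negP => /eqP e; move/eqP: ab0; apply; lra.
Qed.

(** Cauchy-Schwarz for [y] and the component of [x] orthogonal to [w]. It makes a long [y] force a
    small width in every direction orthogonal to [y]. *)
Lemma bessel_wedge2 x y w : dotv w w = 1 -> dotv w y = 0 ->
  dotv x w ^+ 2 * dotv y y <= wedge2 x y.
Proof.
move=> ww wy; have := cauchy_schwarz_dotv (x - dotv x w *: w) y.
rewrite !dotvE ww wy (dotvC w x) /wedge2; nra.
Qed.

End reflection.

Lemma dotv_delta (R : realType) n (i : 'I_n) (y : 'rV[R]_n) :
  dotv (delta_mx 0 i) y = y 0 i.
Proof.
rewrite /dotv (bigD1 i)//= big1 ?addr0 => [|j ji]; rewrite mxE !eqxx ?mul1r//.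
by rewrite (negbTE ji) mul0r.
Qed.

Lemma exists_orthogonal (R : realType) n (y : 'rV[R]_n.+2) :
  exists w, dotv w w = 1 /\ dotv w y = 0.
Proof.
suff [u [u0 uy]] : exists u, u != 0 /\ dotv u y = 0.
  exists ((enorm u)^-1 *: u); rewrite !dotvE uy mulr0; split => //.
  by rewrite -sqr_enorm; field; rewrite gt_eqF// enorm_gt0.
pose e i : 'rV[R]_n.+2 := delta_mx 0 i.
pose i1 : 'I_n.+2 := lift ord0 ord0.
have e0 i : e i != 0.
  by apply/eqP => /rowP/(_ i); rewrite !mxE !eqxx /= => /eqP; rewrite oner_eq0.
have [y0|y0] := eqVneq (y 0 ord0) 0; first by exists (e ord0); rewrite dotv_delta.
exists (y 0 ord0 *: e i1 - y 0 i1 *: e ord0); split; last first.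
  by rewrite !dotvE !dotv_delta; ring.
apply/eqP => /rowP/(_ i1); rewrite !mxE !eqxx /= mulr1 mulr0 subr0.
exact/eqP.
Qed.

Section net.
Context {R : realType} {n : nat}.

Lemma continuous_sqr_dist (u : 'rV[R]_n) :
  continuous (fun w : 'rV[R]_n => dotv (w - u) (w - u)).
Proof.
move=> w; rewrite /continuous_at /dotv.
refine (@cvg_big _ _ +%R 0 predT _ _ (nbhs w) _
  (fun i (x : 'rV[R]_n) => (x - u) 0 i * (x - u) 0 i) _ _ _) => [x|i _].
  exact: add_continuous.
have : (fun x : 'rV[R]_n => (x - u) 0 i) x @[x --> w] --> (w - u) 0 i.
  rewrite mxE [X in _ --> _ + X]mxE.
  under eq_cvg do rewrite mxE [X in _ + X]mxE.
  have FF : Filter (nbhs w) := nbhs_filter w.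
  by apply: (@cvgB _ _ _ (nbhs w) FF);
    [exact: (@coord_continuous R 1 n 0 i w)|exact: cvg_cst].
by move=> h; exact: (cvgM h h).
Qed.

(** The sphere is compact, being closed in a cube; the net consists of the centres of a finite
    subcover by open balls of radius [d]. *)
Lemma sphere_net (d : R) : 0 < d -> exists s : seq 'rV[R]_n,
  (forall u, u \in s -> dotv u u = 1) /\
  (forall w, dotv w w = 1 ->
     exists2 u, u \in s & dotv (w - u) (w - u) <= d ^+ 2).
Proof.
move=> d0; pose S : set 'rV[R]_n := [set w | dotv w w = 1].
have cS : compact S.
  apply: subclosed_compact (rV_compact (fun=> @segment_compact R (-1) 1)) _.
  rewrite (_ : S = (fun w => dotv (w - 0) (w - 0)) @^-1` [set 1]).
    apply: preimage_closed; last exact: closed_eq.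
    by move=> w _; exact: continuous_sqr_dist.
    by apply/seteqP; split => w; rewrite /S /= subr0.
  move=> w Sw i; rewrite /= in_itv /= -ler_norml -ler_sqr ?nnegrE// expr1n.
  rewrite real_normK ?num_real// -Sw /dotv (bigD1 i)//= -expr2 lerDl.
  by apply: sumr_ge0 => j _; rewrite -expr2 sqr_ge0.
move: cS; rewrite compact_cover => /(_ _ S
  (fun u => [set w | dotv (w - u) (w - u) < d ^+ 2])) [].
- move=> u _; apply: (@open_comp _ _ _ [set t : R | t < d ^+ 2]); last exact: open_lt.
  by move=> w _; exact: continuous_sqr_dist.
- by move=> w Sw; exists w => //=; rewrite subrr dotv0l exprn_gt0.
move=> D DS SD; exists (finmap.enum_fset D); split => [u uD|w /SD[u uD wu]].
  by have := DS u uD; rewrite inE.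
by exists u => //; exact: ltW.
Qed.

End net.

(** * Shrinking by iterated symmetrization *)

Section symmetrization.
Context {R : realType} {n : nat}.
Local Notation V := 'rV[R]_n.+2.
Local Notation mu := (rV_lebesgue R n.+2).
Implicit Types (A B : set V) (s : seq V).

Definition in_ball (A : set V) (rho : R) := forall x, A x -> dotv x x <= rho ^+ 2.

(** A bound for a whole cap of directions about [u]: the caps about a finite net cover the sphere,
    so finitely many symmetrizations control every width. *)
Definition width_near (A : set V) (d : R) (u : V) (h : R) :=
  forall w, dotv w w = 1 -> dotv (w - u) (w - u) <= d ^+ 2 ->
  forall x, A x -> `|dotv x w| <= h.

Lemma in_ball_width A rho w x : 0 <= rho -> in_ball A rho -> dotv w w = 1 ->
  A x -> `|dotv x w| <= rho.
Proof.
move=> rho0 Ar w1 Ax; rewrite -[rho]mulr1; apply: normr_dotv_le => //.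
  exact: Ar.
by rewrite w1 expr1n.
Qed.

(* For each [u] of the net, one step in the direction [u - w0] or [u + w0],
   whichever has a nonzero first coordinate, halves the deficit of all the widths
   controlled so far and transports the deficit at [w0] to [u]. *)
Lemma symmetrize_net (s : seq V) (w0 : V) (rho r d e : R) A B :
  dotv w0 w0 = 1 -> w0 0 ord0 != 0 -> 0 <= rho -> 0 <= e ->
  (forall u, u \in s -> dotv u u = 1) ->
  measurable A -> measurable B ->
  (forall x y, A x -> B y -> wedge2 x y <= r) -> in_ball A rho ->
  width_near A d w0 (rho * (1 - e)) ->
  exists A' B', [/\ measurable A' /\ measurable B',
    mu A' = mu A /\ mu B' = mu B,
    (forall x y, A' x -> B' y -> wedge2 x y <= r),
    in_ball A' rho &
    (forall u, u \in w0 :: s -> width_near A' d u (rho * (1 - e / 2 ^+ size s)))].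
Proof.
move=> w01 w00 rho0 e0 s1 mA mB AB Ar wA.
elim: s s1 => [|u s IH] s1.
  exists A, B; split => // u; rewrite inE => /eqP ->.
  by rewrite expr0 divr1.
have [|A' [B' [[mA' mB'] [muA muB] AB' Ar' wA']]] := IH.
  by move=> v vs; apply: s1; rewrite inE vs orbT.
have u1 : dotv u u = 1 by apply: s1; rewrite inE eqxx.
have [b b1 ub] : exists2 b : R, b ^+ 2 = 1 & (u - b *: w0) 0 ord0 != 0.
  have [u0|u0] := eqVneq ((u - 1 *: w0) 0 ord0) 0; last by exists 1; rewrite ?expr1n.
  exists (-1); first by rewrite sqrrN expr1n.
  move: u0; rewrite !mxE mul1r mulN1r opprK => /eqP; rewrite subr_eq0 => /eqP ->.
  by rewrite -mulr2n mulrn_eq0.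
set k := (u - b *: w0) 0 ord0 in ub.
have uw0 : u != b *: w0.
  by apply: contra ub => /eqP uw; rewrite /k -uw subrr mxE.
pose v := k^-1 *: (u - b *: w0).
have v1 : v 0 ord0 = 1 by rewrite /v mxE mulVf.
have v0 : v != 0 by rewrite scaler_eq0 invr_eq0 (negbTE ub) subr_eq0.
have bw : dotv (b *: w0) (b *: w0) = 1 by rewrite !dotvE w01 mulr1 -expr2.
have vu : reflv v u = b *: w0 by rewrite reflv_swap ?invr_eq0// bw.
exists (steiner v A'), (steiner v B'); split.
- by split; exact: measurable_steiner.
- by rewrite !steiner_measure.
- exact: steiner_wedge2.
- exact: steiner_ball.
set h := rho * (1 - e / 2 ^+ size s) in wA'.
have hE : (h + rho) / 2 = rho * (1 - e / 2 ^+ (size s).+1).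
  by rewrite /h exprS; field; rewrite expf_neq0.
(* Each width is averaged with the one in the reflected direction. Near the new [u] the first is at
   most [rho] and the reflected direction is, up to the sign [b], near [w0]; near the old points the
   first is at most [h] and the second at most [rho]. *)
move=> u'; rewrite /= -hE in_cons orbCA => /orP[/eqP ->|u's] w w1 wu x.
  rewrite [h + _]addrC; apply: steiner_width => // {}x A'x.
    exact: (in_ball_width rho0 Ar').
  have -> : `|dotv x (reflv v w)| = `|dotv x (b *: reflv v w)|.
    apply/eqP; rewrite -(@eqrXn2 _ 2)// !real_normK ?num_real// dotvZr.
    by rewrite exprMn b1 mul1r.
  apply: (wA' w0) => //; first by rewrite inE eqxx.
    by rewrite dotvZl dotvZr mulrA -expr2 b1 mul1r dotv_reflv.
  have -> : b *: reflv v w - w0 = b *: reflv v (w - u).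
    by rewrite reflvB vu (scalerBr b (reflv v w)) (scalerA b b) -expr2 b1 scale1r.
  by rewrite dotvZl dotvZr mulrA -expr2 b1 mul1r dotv_reflv.
apply: steiner_width => // {}x A'x.
  exact: (wA' u').
by apply: (in_ball_width rho0 Ar') => //; rewrite dotv_reflv.
Qed.

(* [steiner_measure] needs directions with a nonzero first coordinate. *)
Lemma tilt_width A (w0 : V) (rho k t : R) : 0 <= rho -> 0 < t < 1 ->
  in_ball A rho -> dotv w0 w0 = 1 -> 
  (forall x, A x -> `|dotv x w0| <= rho * k) ->
  exists w1, [/\ dotv w1 w1 = 1, w1 0 ord0 != 0 &
    forall x, A x -> `|dotv x w1| <= rho * (k + t)].
Proof.
move=> rho0 /andP[t0 t1] Ar w01 Aw.
have [w00|w00] := eqVneq (w0 0 ord0) 0; last first.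
  exists w0; split => // x /Aw /le_trans; apply.
  by rewrite ler_wpM2l// lerDl ltW.
pose e0 : V := delta_mx 0 ord0.
have e00 : e0 0 ord0 = 1 by rewrite mxE !eqxx.
have ew : dotv e0 w0 = 0 by rewrite dotv_delta.
have ee : dotv e0 e0 = 1 by rewrite dotv_delta.
(* [w0] is rotated towards the first basis vector by an angle of sine [t] and cosine [c], which adds
   at most [rho * t] to the width. *)
pose c := Num.sqrt (1 - t ^+ 2).
have t21 : 0 <= 1 - t ^+ 2 by rewrite subr_ge0 expr_le1// ltW.
have c2 : c ^+ 2 = 1 - t ^+ 2 by rewrite sqr_sqrtr.
have c1 : c <= 1.
  by rewrite -(@expr_le1 _ 2) ?sqrtr_ge0// c2 lerBlDr lerDl sqr_ge0.
exists (c *: w0 + t *: e0); split.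
- rewrite !dotvE (dotvC w0) ew ee w01.
  by rewrite !mulr0 addr0 add0r !mulr1 -!expr2 c2 subrK.
- by rewrite !mxE w00 eqxx mulr0 add0r mulr1 gt_eqF.
move=> x Ax; rewrite !dotvE mulrDr (le_trans (ler_normD _ _))// lerD//.
  rewrite normrM (ger0_norm (sqrtr_ge0 _)) (le_trans _ (Aw x Ax))//.
  by rewrite ler_piMl.
by rewrite normrM gtr0_norm// mulrC ler_pM2r//; exact: in_ball_width Ax.
Qed.

Lemma symmetrize_shrink (c : R) : 1 < c -> exists2 eta : R, 0 < eta < 1 &
  forall (rho r : R) A B y, 0 < rho -> 0 < r -> measurable A -> measurable B ->
  (forall x y, A x -> B y -> wedge2 x y <= r ^+ 2) -> in_ball A rho ->
  B y -> (c * r / rho) ^+ 2 <= dotv y y ->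
  exists A' B', [/\ measurable A' /\ measurable B',
    mu A' = mu A /\ mu B' = mu B,
    (forall x y, A' x -> B' y -> wedge2 x y <= r ^+ 2) &
    in_ball A' (eta * rho)].
Proof.
move=> c1; have c0 : 0 < c by lra.
pose k := c^-1; have k0 : 0 < k by rewrite invr_gt0.
have k1 : k < 1 by rewrite invf_lt1.
(* With this [d], the width factor [k], the tilt [2 * d] and the radius [d] of the cap add up to
   [1 - d]. The net, and with it the ratio, depends only on [c] and the dimension. *)
pose d := (1 - k) / 4; have d0 : 0 < d by rewrite /d; lra.
have [s [s1 sP]] := @sphere_net R n.+2 d d0.
have p2 : 0 < (2 : R) ^+ size s by rewrite exprn_gt0.
have p1 : 1 <= (2 : R) ^+ size s by rewrite exprn_ege1// ler1n.
exists (1 - d / 2 ^+ size s).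
  have : d / 2 ^+ size s <= d by rewrite ler_pdivrMr// ler_peMr// ltW.
  have : 0 < d / 2 ^+ size s by rewrite divr_gt0.
  by rewrite /d in d0 *; move=> ? ?; apply/andP; split; lra.
move=> rho r A B y rho0 r0 mA mB AB Ar By yc.
have yy : 0 < dotv y y by rewrite (lt_le_trans _ yc)// exprn_gt0// !mulr_gt0// invr_gt0.
have [w0 [w01 w0y]] := exists_orthogonal y.
(* As [w0] is orthogonal to [y], Bessel bounds the width by [r] divided by the norm of [y], which is
   at least [c * r / rho]. *)
have Aw0 x : A x -> `|dotv x w0| <= rho * k.
  move=> Ax; rewrite -ler_sqr ?nnegrE ?mulr_ge0 ?(ltW k0) ?(ltW rho0)//.
  rewrite real_normK ?num_real//.
  have h1 := bessel_wedge2 x w01 w0y; have h2 := AB _ _ Ax By.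
  have h3 : dotv x w0 ^+ 2 * (c * r / rho) ^+ 2 <= r ^+ 2.
    by apply: le_trans h2; apply: le_trans h1; rewrite ler_wpM2l ?sqr_ge0.
  rewrite -(ler_pM2r (_ : 0 < (c * r / rho) ^+ 2)); last first.
    by rewrite exprn_gt0// !mulr_gt0// invr_gt0.
  apply: le_trans h3 _; rewrite -exprMn /k.
  rewrite (_ : rho / c * _ = r)//; field; rewrite !gt_eqF//.
have [|w1 [w11 w10 Aw1]] := tilt_width (ltW rho0) _ Ar w01 Aw0 (t := 2 * d).
  by rewrite /d in d0 *; apply/andP; split; lra.
have wA : width_near A d w1 (rho * (1 - d)).
  move=> w ww ww1 x Ax; rewrite -(subrK w1 w) dotvDr (le_trans (ler_normD _ _))//.
  have h1 := Aw1 x Ax.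
  have h2 := normr_dotv_le (ltW rho0) (ltW d0) (Ar x Ax) ww1.
  by rewrite (le_trans (lerD h2 h1))// -mulrDr ler_pM2l// /d; lra.
have [A' [B' [[mA' mB'] [muA muB] AB' Ar' wA']]] :=
  symmetrize_net w11 w10 (ltW rho0) (ltW d0) s1 mA mB AB Ar wA.
exists A', B'; split => // x A'x.
have [->|x0] := eqVneq x 0; first by rewrite dotv0l sqr_ge0.
have ex : 0 < enorm x by rewrite enorm_gt0.
(* The product of [x] with its own direction [w] is its norm, and [w] lies in the cap of some point
   of the net. *)
pose w := (enorm x)^-1 *: x.
have ww : dotv w w = 1.
  by rewrite !dotvE -sqr_enorm; field; rewrite gt_eqF.
have [u us wu] := sP w ww.
have us' : u \in w1 :: s by rewrite inE us orbT.
have := wA' u us' w ww wu x A'x.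
rewrite dotvZr -sqr_enorm expr2 mulKf ?gt_eqF// (gtr0_norm ex) mulrC => h.
by rewrite -expr2 lerXn2r// nnegrE ltW// (lt_le_trans ex).
Qed.

End symmetrization.

Lemma lee_mul_limit (R : realType) (a b : (\bar R)^nat) (x y z : \bar R) :
  (forall k, 0 <= a k)%E -> (forall k, 0 <= b k)%E ->
  a @ \oo --> x -> b @ \oo --> y ->
  (forall k, a k * b k <= z)%E -> (x * y <= z)%E.
Proof.
move=> a0 b0 ax bY abz.
have z0 : (0 <= z)%E by rewrite (le_trans _ (abz 0%N))// mule_ge0.
(* Multiplication is not continuous at (0, +oo), so zero limits are treated apart. *)
have [->|xn0] := eqVneq x 0%E; first by rewrite mul0e.
have [->|yn0] := eqVneq y 0%E; first by rewrite mule0.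
apply: (cvge_to_le (cvgeM _ ax bY)); last by near=> k; exact: abz.
by rewrite mule_defE (negbTE xn0) (negbTE yn0).
Unshelve. all: by end_near. Qed.

(** * Euclidean balls and the volume product of two sets *)

Section euclidean_ball.
Context {R : realType} {n : nat}.
Local Notation mu := (rV_lebesgue R n).

Definition eball (rho : R) : set 'rV[R]_n := [set x | dotv x x < rho ^+ 2].

Lemma measurable_sqr_norm : measurable_fun setT (fun x : 'rV[R]_n => dotv x x).
Proof.
apply: measurable_sum => i; apply: measurable_funM; exact: measurable_coord.
Qed.

Lemma measurable_eball rho : measurable (eball rho).
Proof.
rewrite /eball -[X in measurable X]setTI.
have := measurable_sqr_norm measurableT (measurable_itv `]-oo, (rho ^+ 2)[).
by congr measurable; apply/seteqP; split => x [_] /=; rewrite in_itv.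
Qed.

Lemma rV_lebesgue_eball rho : 0 < rho ->
  mu (eball rho) = ((rho ^+ n)%:E * mu (eball 1))%E.
Proof.
move=> rho0; have ri0 : 0 < rho^-1 by rewrite invr_gt0.
have := rV_lebesgue_affine 0 ri0 (measurable_eball 1); rewrite invrK => <-.
congr (mu _); apply/seteqP; split => x; rewrite /eball /= addr0 !dotvE expr1n.
  by rewrite mulrA -expr2 exprVn mulrC ltr_pdivrMr ?exprn_gt0// mul1r.
by rewrite mulrA -expr2 exprVn mulrC ltr_pdivrMr ?exprn_gt0// mul1r.
Qed.

Lemma eball_bigcup : \bigcup_k eball k%:R = [set: 'rV[R]_n].
Proof.
apply/seteqP; split => // x _; exists (Num.truncn (enorm x)).+1 => //.
by rewrite /eball /= -sqr_enorm ltr_sqr ?nnegrE ?enorm_ge0// truncnS_gt.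
Qed.

Lemma rV_lebesgue_eball_lty rho : (mu (eball rho) < +oo)%E.
Proof.
apply: (@le_lt_trans _ _ (mu [set x : 'rV[R]_n | forall i,
    `[- `|rho|, `|rho|]%classic (x 0 i)])).
  apply: le_measure; rewrite ?inE; first exact: measurable_eball.
    rewrite (_ : mkset _ = \bigcap_(i in [set: 'I_n])
      ((fun x : 'rV[R]_n => x 0 i) @^-1` `[- `|rho|, `|rho|]%classic)); last first.
      by apply/seteqP; split=> [t qt i _|t qt i]; [exact: qt|exact: (qt i)].
    apply: fin_bigcap_measurable => // i _; rewrite -[X in measurable X]setTI.
    exact: measurable_coord.
  move=> x; rewrite /eball /= => xr i; rewrite in_itv /= -ler_norml.
  rewrite -ler_sqr ?nnegrE// !real_normK ?num_real// (le_trans _ (ltW xr))//.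
  rewrite /dotv (bigD1 i)//= -expr2 lerDl.
  by apply: sumr_ge0 => j _; rewrite -expr2 sqr_ge0.
rewrite (@rV_lebesgue_box R n (fun=> `[- `|rho|, `|rho|]%classic))//.
elim/big_rec: _ => [|i x _ x_fin]; first by rewrite ltry.
rewrite lebesgue_measure_itv /= lte_fin; case: ifPn => _; last by rewrite mul0e.
by rewrite -EFinB lte_mul_pinfty// lee_fin; rewrite opprK addr_ge0.
Qed.

End euclidean_ball.

Section sine_santalo_sets.
Context {R : realType} {n : nat}.
Local Notation V := 'rV[R]_n.+2.
Local Notation mu := (rV_lebesgue R n.+2).
Local Notation omega := (mu (eball 1)).
Implicit Types (A B : set V).

(** [in_ball] refers to a closed ball and [eball] to an open one, hence the larger radius. *)
Lemma in_ball_measure A rho rho' : 0 < rho -> rho < rho' -> measurable A ->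
  in_ball A rho -> (mu A <= (rho' ^+ n.+2)%:E * omega)%E.
Proof.
move=> rho0 rr mA Ar; have r'0 : 0 < rho' by exact: lt_trans rr.
rewrite -rV_lebesgue_eball//; apply: le_measure; rewrite ?inE//.
  exact: measurable_eball.
move=> x /Ar /le_lt_trans; apply.
by rewrite ltr_sqr// ?nnegrE ltW.
Qed.

(** If the bound failed, the second set could never be contained in the ball of radius [c * r / rk],
    so the first set could be shrunk forever and would have measure zero. *)
Lemma sine_santalo_bounded A B (r c rho : R) : 1 < c -> 0 < r -> 0 < rho ->
  measurable A -> measurable B ->
  (forall x y, A x -> B y -> wedge2 x y <= r ^+ 2) -> in_ball A rho ->
  (mu A * mu B <= ((c ^+ 2 * r) ^+ n.+2)%:E * (omega * omega))%E.
Proof.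
move=> c1 r0 rho0 mA mB AB Ar; have c0 : 0 < c by lra.
have [eta /andP[eta0 eta1] shrink] := @symmetrize_shrink R n c c1.
set K := (_ * (omega * omega))%E.
apply: contrapT => /negP; rewrite -ltNge => large.
have iter k : exists A' B', [/\ measurable A' /\ measurable B',
    mu A' = mu A /\ mu B' = mu B,
    (forall x y, A' x -> B' y -> wedge2 x y <= r ^+ 2) &
    in_ball A' (eta ^+ k * rho)].
  elim: k => [|k [A' [B' [[mA' mB'] [muA muB] AB' Ar']]]].
    by exists A, B; split => //; rewrite expr0 mul1r.
  have rk0 : 0 < eta ^+ k * rho by rewrite mulr_gt0 ?exprn_gt0.
  set rk := eta ^+ k * rho in Ar' rk0.
  have rkc : 0 < c * r / rk by rewrite !mulr_gt0 ?invr_gt0.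
  have [Bs|] := pselect (B' `<=` eball (c * r / rk)).
    (* The radii [c * rk] and [c * r / rk] have the product [c ^+ 2 * r]; one factor [c] pays for
       the open ball, the other for the threshold of [symmetrize_shrink]. *)
    have hA : (mu A' <= ((c * rk) ^+ n.+2)%:E * omega)%E.
      by apply: (in_ball_measure rk0 _ mA' Ar'); rewrite ltr_pMl.
    have hB : (mu B' <= ((c * r / rk) ^+ n.+2)%:E * omega)%E.
      rewrite -rV_lebesgue_eball//; apply: le_measure; rewrite ?inE//.
      exact: measurable_eball.
    move: large; rewrite ltNge => /negP; case; rewrite -muA -muB.
    apply: le_trans (lee_pmul _ _ hA hB) _; rewrite ?measure_ge0//.
    rewrite muleACA -EFinM -exprMn.
    rewrite (_ : c * rk * (c * r / rk) = c ^+ 2 * r)//.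
    by field; rewrite gt_eqF.
  move=> /existsNP[y /not_implyP[B'y]]; rewrite /eball /= => /negP.
  rewrite -leNgt => ycr.
  have [A2 [B2 [m2 [muA2 muB2] AB2 Ar2]]] :=
    shrink _ _ _ _ _ rk0 r0 mA' mB' AB' Ar' B'y ycr.
  by exists A2, B2; split => //; rewrite ?muA2 ?muB2// exprS -mulrA.
have A0 : mu A = 0%E.
  apply/eqP; rewrite eq_le measure_ge0 andbT.
  have muAk k : (mu A <= ((2 * rho) ^+ n.+2 * (eta ^+ n.+2) ^+ k)%:E * omega)%E.
    have [A' [B' [[mA' mB'] [<- muB] AB' Ar']]] := iter k.
    have rk0 : 0 < eta ^+ k * rho by rewrite mulr_gt0 ?exprn_gt0.
    rewrite -exprM mulnC exprM -exprMn.
    apply: (in_ball_measure rk0 _ mA' Ar').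
    by rewrite (mulrC (2 * rho)) mulrA mulrAC ltr_pMr//; lra.
  have omega_fin : omega \is a fin_num.
    by rewrite ge0_fin_numE ?measure_ge0// rV_lebesgue_eball_lty.
  rewrite -(mul0e omega).
  apply: (@cvge_to_ge nat \oo _ R
    (fun k => ((2 * rho) ^+ n.+2 * (eta ^+ n.+2) ^+ k)%:E * omega)%E); last first.
    by near=> k; exact: (muAk k).
  apply: cvgeZr => //; apply: cvg_EFin; first by near=> k.
  rewrite -[X in _ --> X](mulr0 ((2 * rho) ^+ n.+2)).
  apply: cvgMr; apply: cvg_expr.
  by rewrite normrX gtr0_norm// exprn_ilt1// ltW.
move: large; rewrite A0 mul0e ltNge => /negP; apply.
by rewrite /K mule_ge0 ?mule_ge0// lee_fin exprn_ge0// mulr_ge0 ?sqr_ge0// ltW.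
Unshelve. all: by end_near. Qed.

Lemma sine_santalo_sets A B (r rho : R) : 0 <= r -> r < rho ->
  measurable A -> measurable B ->
  (forall x y, A x -> B y -> sine_bracket x y <= r) ->
  (mu A * mu B <= (rho ^+ n.+2)%:E * (omega * omega))%E.
Proof.
move=> r0 rrho mA mB AB.
(* A positive radius even if [r] is zero; [c] is then chosen so that [c ^+ 2 * r1] is [rho]. *)
pose r1 := (r + rho) / 2.
have r10 : 0 < r1 by rewrite /r1; lra.
have rr1 : r <= r1 by rewrite /r1; lra.
have r1rho : r1 < rho by rewrite /r1; lra.
pose c := Num.sqrt (rho / r1).
have c2 : c ^+ 2 = rho / r1.
  by rewrite sqr_sqrtr// divr_ge0// ltW// (lt_trans r10).
have c1 : 1 < c.
  rewrite -ltr_sqr ?nnegrE ?sqrtr_ge0// expr1n c2 ltr_pdivlMr// mul1r//.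
have -> : rho = c ^+ 2 * r1 by rewrite c2; field; rewrite gt_eqF.
have AB1 x y : A x -> B y -> wedge2 x y <= r1 ^+ 2.
  move=> Ax By; rewrite -sine_bracket_le ?(ltW r10)//.
  exact: le_trans (AB _ _ Ax By) rr1.
(* The bound for bounded sets does not depend on the radius of the ball, so it survives the
   exhaustion of [A]. *)
pose Ak k := A `&` eball k.+1%:R.
apply: (@lee_mul_limit _ (mu \o Ak) (fun=> mu B)); rewrite /= ?measure_ge0//.
- have mAk k : measurable (Ak k) by apply: measurableI => //; exact: measurable_eball.
  have -> : A = \bigcup_k Ak k.
    rewrite /Ak -setI_bigcupr -[LHS]setIT; congr (_ `&` _).
    apply/seteqP; split => // x _.
    have : (\bigcup_k eball k%:R) x by rewrite eball_bigcup.
    move=> [k _ xk]; exists k => //; move: xk; rewrite /eball /= => /lt_le_trans; apply.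
    by rewrite ler_sqr ?nnegrE// ler_nat.
  apply: nondecreasing_cvg_mu => //.
    exact: bigcupT_measurable.
  move=> i j ij; apply/subsetPset => x [Ax xi]; split => //; move: xi.
  by rewrite /eball /= => /lt_le_trans; apply; rewrite ler_sqr ?nnegrE// ler_nat.
- exact: cvg_cst.
- move=> k; apply: (@sine_santalo_bounded _ _ r1 c k.+1%:R) => //.
  + by apply: measurableI => //; exact: measurable_eball.
  + by move=> x y [Ax _]; exact: AB1.
  + by move=> x [_]; rewrite /eball /= => /ltW.
Qed.

End sine_santalo_sets.

(** * The Prekopa-Leindler inequality on the line *)

Section brunn_minkowski_line.
Context {R : realType}.
Local Notation lam := (@lebesgue_measure R).
Implicit Types A B C : set R.

(** If [A] is bounded above, a cut point of [A] within [e] of the supremum loses measure at most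
    [e]; otherwise cut points beyond every integer exist. *)
Lemma lebesgue_measure_le_cut A (c : \bar R) : (0 <= c)%E -> measurable A ->
  (forall a, A a -> (lam (A `&` [set x | (x < a)%R]) <= c)%E) ->
  (lam A <= c)%E.
Proof.
move=> c0 mA Ac.
have mlt (a : R) : measurable [set x : R | x < a].
  rewrite (_ : mkset _ = `]-oo, a[%classic); first exact: measurable_itv.
  by apply/seteqP; split => x; rewrite /= in_itv.
have [->|/set0P[a0 Aa0]] := eqVneq A set0; first by rewrite measure0.
have [hA|hA] := pselect (has_ubound A).
  have sA : has_sup A by split; [exists a0|].
  apply/lee_addgt0Pr => e e0.
  have [a Aa ae] := sup_adherent e0 sA.
  pose I := `[a, sup A]%classic.
  have mI : measurable I by exact: measurable_itv.
  have mAa : measurable (A `&` [set x | x < a]) by exact: measurableI.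
  have AI : A `<=` (A `&` [set x | x < a]) `|` I.
    move=> x Ax; have [xa|ax] := ltP x a; [by left|right].
    by rewrite /I /= in_itv /= ax sup_upper_bound.
  apply: (@le_trans _ _ (lam ((A `&` [set x | x < a]) `|` I))).
    by apply: le_measure; rewrite ?inE//; exact: measurableU.
  have LI : (lam I <= e%:E)%E.
    rewrite lebesgue_measure_itv /= lte_fin; case: ifPn => _; last first.
      by rewrite lee_fin ltW.
    by rewrite -EFinB lee_fin; lra.
  have mU := @measureU2 _ _ _ lam _ _ mAa mI; apply: (le_trans mU).
  exact: leeD (Ac a Aa) LI.
pose Ak (k : nat) := A `&` [set x | x < k%:R].
have AE : A = \bigcup_k Ak k.
  rewrite /Ak -setI_bigcupr -[LHS]setIT; congr (_ `&` _).
  apply/seteqP; split => // x _; exists (Num.truncn `|x|).+1 => //=.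
  by rewrite (le_lt_trans (ler_norm _))// truncnS_gt.
have mAk k : measurable (Ak k) by exact: measurableI.
have := @nondecreasing_cvg_mu _ _ _ lam Ak mAk; rewrite -AE => /(_ mA) cv.
apply: (cvge_to_le (cv _)).
  move=> i j ij; apply/subsetPset => x [Ax xi]; split => //.
  by move: xi => /= /lt_le_trans; apply; rewrite ler_nat.
near=> k => /=.
have [a Aa ka] : exists2 a, A a & k%:R <= a.
  apply: contrapT => h; apply: hA; exists k%:R => x Ax.
  by rewrite leNgt; apply/negP => kx; apply: h; exists x => //; exact: ltW.
apply: le_trans (Ac a Aa); apply: le_measure; rewrite ?inE//.
- exact: mAk.
- by apply: measurableI => //; exact: mlt.
by move=> x [Ax] /= xk; split => //=; exact: lt_le_trans ka.
Unshelve. all: by end_near. Qed.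

Lemma lebesgue_measure_opp A : measurable A -> lam (-%R @^-1` A) = lam A.
Proof. exact: lebesgue_measureN. Qed.

Lemma lebesgue_measure_ge_cut B (c : \bar R) : (0 <= c)%E -> measurable B ->
  (forall b, B b -> (lam (B `&` [set x | (b < x)%R]) <= c)%E) ->
  (lam B <= c)%E.
Proof.
move=> c0 mB Bc; rewrite -(lebesgue_measure_opp mB).
have mgt (b : R) : measurable [set x : R | b < x].
  rewrite (_ : mkset _ = `]b, +oo[%classic); first exact: measurable_itv.
  by apply/seteqP; split => x; rewrite /= in_itv /= andbT.
have mN : measurable_fun [set: R] (-%R : R -> R) by exact: measurable_funN.
apply: lebesgue_measure_le_cut => //.
  by rewrite -[X in measurable X]setTI; exact: mN.
move=> b Bb; have := Bc _ Bb; rewrite -lebesgue_measure_opp; last exact: measurableI.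
congr (_ <= _)%E; congr (lam _).
by apply/seteqP; split => x [Bx /= h]; split => //=; move: h; rewrite ltrN2.
Qed.

(* The halves of [A] left of [a] and of [B] right of [b], moved to (A + b) / 2 and
   (a + B) / 2, are disjoint subsets of [C]. *)
Lemma brunn_minkowski_midpoint A B C : A !=set0 -> B !=set0 ->
  measurable A -> measurable B -> measurable C ->
  (forall a b, A a -> B b -> C ((a + b) / 2)) ->
  (lam A + lam B <= 2%:E * lam C)%E.
Proof.
move=> [a1 Aa1] [b1 Bb1] mA mB mC ABC.
have mgt (b : R) : measurable [set x : R | b < x].
  rewrite (_ : mkset _ = `]b, +oo[%classic); first exact: measurable_itv.
  by apply/seteqP; split => x; rewrite /= in_itv /= andbT.
have mlt (a : R) : measurable [set x : R | x < a].
  rewrite (_ : mkset _ = `]-oo, a[%classic); first exact: measurable_itv.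
  by apply/seteqP; split => x; rewrite /= in_itv.
have key a b : A a -> B b ->
    (lam (A `&` [set x | (x < a)%R]) + lam (B `&` [set x | (b < x)%R]) <=
     2%:E * lam C)%E.
  move=> Aa Bb; set A1 := A `&` _; set B1 := B `&` _.
  have mA1 : measurable A1 by exact: measurableI.
  have mB1 : measurable B1 by exact: measurableI.
  have p2 : (0 : R) < 2 by [].
  have hA := lebesgue_measure_affine (- b) p2 mA1.
  have hB := lebesgue_measure_affine (- a) p2 mB1.
  set C1 := (X in lam X) in hA; set C2 := (X in lam X) in hB.
  have mC1 : measurable C1.
    by rewrite -[X in measurable X]setTI; exact: measurable_affine.
  have mC2 : measurable C2.
    by rewrite -[X in measurable X]setTI; exact: measurable_affine.
  have : (lam C1 + lam C2 <= lam C)%E.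
    rewrite -measureU//; last first.
      apply/seteqP; split => // x [[_ /= h1] [_ /= h2]]; lra.
    apply: le_measure; rewrite ?inE//; first exact: measurableU.
    move=> x [[/= Ax _]|[/= Bx _]].
      by rewrite (_ : x = (2 * x + - b + b) / 2); [exact: ABC|lra].
    by rewrite (_ : x = (a + (2 * x + - a)) / 2); [exact: ABC|lra].
  rewrite hA hB -ge0_muleDr ?measure_ge0// => h.
  have := lee_wpmul2l (_ : (0 <= 2%:E)%E) h; rewrite lee_fin => /(_ (ltW p2)).
  by rewrite muleA -EFinM divff// mul1e.
(* With [lam C] finite, the measures can be moved across the inequality, so the cut in [A] is
   removed first and then the cut in [B]. *)
have [->|Cfin] := eqVneq (lam C) +oo%E.
  by rewrite mulry gtr0_sg// mul1e leey.
have C2fin : (2%:E * lam C < +oo)%E.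
  by rewrite lte_mul_pinfty// ltey.
have key1 b : B b -> (lam A + lam (B `&` [set x | (b < x)%R]) <= 2%:E * lam C)%E.
  move=> Bb.
  have fin : lam (B `&` [set x | (b < x)%R]) \is a fin_num.
    rewrite ge0_fin_numE ?measure_ge0//; apply: le_lt_trans C2fin.
    apply: le_trans (key _ _ Aa1 Bb).
    by rewrite leeDr// measure_ge0.
  rewrite -leeBrDr//; apply: lebesgue_measure_le_cut => //.
    rewrite leeBrDr// add0e (le_trans _ (key _ _ Aa1 Bb))//.
    by rewrite leeDr// measure_ge0.
  by move=> a Aa; rewrite leeBrDr//; exact: key.
have fin : lam A \is a fin_num.
  rewrite ge0_fin_numE ?measure_ge0//; apply: le_lt_trans C2fin.
  by apply: le_trans (key1 _ Bb1); rewrite leeDl// measure_ge0.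
rewrite addeC -leeBrDr//; apply: lebesgue_measure_ge_cut => //.
  rewrite leeBrDr// add0e (le_trans _ (key1 _ Bb1))//.
  by rewrite leeDl// measure_ge0.
by move=> b Bb; rewrite leeBrDr// addeC; exact: key1.
Qed.

End brunn_minkowski_line.

(** * Layer-cake formulas *)

Section layer_cake.
Local Open Scope ereal_scope.
Context d (T : measurableType d) (R : realType).
Variables (mu : {measure set T -> \bar R}) (smu : sigma_finite setT mu).
Local Notation lam := (@lebesgue_measure R).
Variables (f : T -> \bar R) (w phi : R -> R).
Hypotheses (mf : measurable_fun setT f) (mw : measurable_fun setT w).
Hypotheses (mphi : measurable_fun setT phi) (w0 : forall t, (0 <= w t)%R).

Let E : set (R * T) := [set p | (phi p.1)%:E < f p.2].

Let mE : measurable E.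
Proof.
rewrite /E -[X in measurable X]setTI; apply: measurable_lte => //.
  apply/measurable_EFinP.
  exact: (measurableT_comp mphi measurable_fst).
exact: (measurableT_comp mf measurable_snd).
Qed.

Lemma measurable_superlevel t : measurable [set x | (phi t)%:E < f x].
Proof.
have := measurable_xsection t mE.
by congr measurable; apply/seteqP; split => x; rewrite /xsection /= inE.
Qed.

Lemma measurable_superlevel_measure :
  measurable_fun setT (fun t => mu [set x | (phi t)%:E < f x]).
Proof.
pose mu' : {sigma_finite_measure set T -> \bar R} := sigma_finite_copy smu.
have := measurable_fun_xsection mu' mE.
apply: eq_measurable_fun => t _; congr (mu _).
by apply/seteqP; split => x; rewrite /xsection /= inE.
Qed.

(** Tonelli for the weight [w] on the region below the graph of [f]. It is used with exponential
    levels and weights, and with the identity as level and the indicator of the unit interval as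
    weight. *)
Lemma layer_cake :
  \int[mu]_x \int[lam]_(t in [set t | ((phi t)%:E < f x)%E]) (w t)%:E =
  \int[lam]_t ((w t)%:E * mu [set x | (phi t)%:E < f x]).
Proof.
pose mu' : {sigma_finite_measure set T -> \bar R} := sigma_finite_copy smu.
pose k (p : R * T) := (w p.1)%:E * (\1_E p)%:E.
have mk : measurable_fun setT k.
  apply: emeasurable_funM; apply/measurable_EFinP; last exact: measurable_indic.
  exact: (measurableT_comp mw measurable_fst).
have k0 p : 0 <= k p by rewrite mule_ge0 ?lee_fin.
have fub := @fubini_tonelli _ _ _ _ _ lam mu' k mk k0.
transitivity (\int[mu]_x \int[lam]_t k (t, x)).
  apply: eq_integral => x _; rewrite integral_mkcond; apply: eq_integral => t _.
  rewrite patchE /k /= indicE; case: ifPn => h.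
    by rewrite mem_set ?mule1//; move: h; rewrite inE.
  by rewrite memNset ?mule0//; move: h; rewrite notin_setE.
rewrite -fub; apply: eq_integral => t _.
rewrite -integral_cst; last exact: measurable_superlevel.
rewrite [RHS]integral_mkcond; apply: eq_integral => x _.
rewrite patchE /k /= indicE; case: ifPn => h.
  by rewrite mem_set ?mule1//; move: h; rewrite inE.
by rewrite memNset ?mule0//; move: h; rewrite notin_setE.
Qed.

End layer_cake.

Section exponential_layer_cake.
Context {R : realType}.
Local Notation lam := (@lebesgue_measure R).

(** For positive [y] the domain is the half-line beyond [- ln y], and [- expR (- t)] is a primitive;
    for [y] zero the domain is empty. *)
Lemma integral_expRN_superlevel (y : R) : 0 <= y ->
  (\int[lam]_(t in [set t | ((expR (- t))%:E < y%:E)%E]) (expR (- t))%:E = y%:E)%E.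
Proof.
rewrite le_eqVlt => /predU1P[<-|y0].
  rewrite (_ : mkset _ = set0) ?integral_set0//.
  by apply/seteqP; split => t //=; rewrite lte_fin ltNge expR_ge0.
have ltE t : (expR (- t) < y) = (- ln y < t).
  by rewrite -{1}(lnK y0) ltr_expR ltrNl.
rewrite (_ : mkset _ = `](- ln y), +oo[%classic); last first.
  by apply/seteqP; split => t; rewrite /= in_itv /= andbT lte_fin ltE.
have mexp : measurable_fun setT (fun t : R => expR (- t)).
  by apply: measurableT_comp => //; exact: measurable_funN.
rewrite integral_itv_obnd_cbnd; last first.
  by apply/measurable_EFinP; apply: measurable_funTS.
have ce : continuous (fun t : R => expR (- t)).
  by move=> x; apply: continuous_comp; [exact: opp_continuous|exact: continuous_expR].
have De (x : R) : is_derive x 1 (fun t => - expR (- t)) (expR (- x)).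
  have D1 : is_derive x 1 (expR \o -%R) (expR (- x) * - 1).
    exact: is_derive1_comp.
  have D2 := is_deriveN D1; apply: is_derive_eq.
  by rewrite mulrN1 opprK.
rewrite (@ge0_continuous_FTC2y _ _ (fun t => - expR (- t)) _ 0).
- by rewrite opprK sub0e -EFinN opprK lnK.
- by move=> x _; exact: expR_ge0.
- exact: continuous_subspaceT.
- by rewrite -oppr0; apply: cvgN; exact: cvgr_expR.
- by move=> x _; have [] := De x.
- by apply: cvg_at_right_filter; apply: cvgN; exact: ce.
- by move=> x _; rewrite derive1E; have [] := De x.
Qed.

Lemma exponential_layer_cake d (T : measurableType d)
    (mu : {measure set T -> \bar R}) (f : T -> R) :
  sigma_finite setT mu -> measurable_fun setT f -> (forall x, 0 <= f x) ->
  (\int[mu]_x (f x)%:E = \int[lam]_t ((expR (- t))%:E *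
     mu [set x | ((expR (- t))%:E < (f x)%:E)%E]))%E.
Proof.
move=> smu mf f0.
have mexp : measurable_fun setT (fun t : R => expR (- t)).
  by apply: measurableT_comp => //; exact: measurable_funN.
rewrite -(layer_cake smu _ mexp mexp (fun t => expR_ge0 _)); last first.
  exact/measurable_EFinP.
by apply: eq_integral => x _; rewrite integral_expRN_superlevel.
Qed.

Lemma unit_layer_cake (h : R -> \bar R) : measurable_fun setT h ->
  (forall x, 0 <= h x)%E ->
  (\int[lam]_x mine (h x) 1 = \int[lam]_t ((\1_`]0%R, 1%R[%classic t)%:E *
     lam [set x | (t%:E < h x)%E]))%E.
Proof.
move=> mh h0.
have m1 : measurable_fun setT (\1_`]0%R, 1%R[%classic : R -> R).
  by apply: measurable_indic; exact: measurable_itv.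
have slam : sigma_finite setT lam by exact: sigma_finiteT.
rewrite -(layer_cake slam mh m1 (@measurable_id _ _ setT))//.
apply: eq_integral => x _.
rewrite integral_mkcond (_ : _ \_ _ = EFin \o
    \1_(`]0%R, 1%R[%classic `&` [set t | (t%:E < h x)%E])); last first.
  apply/funext => t; rewrite patchE /= !indicE in_setI.
  by case: ifPn => _; rewrite ?andbT ?andbF.
have ht := h0 x.
rewrite integral_indic// ?setIT; last first.
  apply: measurableI; first exact: measurable_itv.
  rewrite (_ : mkset _ = (fun t : R => t%:E) @^-1` `]-oo, h x[%classic); last first.
    by apply/seteqP; split => t; rewrite /= in_itv.
  rewrite -[X in measurable X]setTI.
  by apply: EFin_measurable => //; exact: emeasurable_itv.
case: (h x) ht => [y||] //= y0.
- rewrite lee_fin in y0.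
  rewrite (_ : _ `&` _ = `]0, (Num.min y 1)[%classic); last first.
    apply/seteqP; split => t; rewrite /= !in_itv /= lte_fin lt_min.
      by move=> [/andP[-> ->] ->].
    by move=> /andP[-> /andP[-> ->]].
  rewrite lebesgue_measure_itv /= lte_fin lt_min ltr01 andbT -EFin_min.
  move: y0; rewrite le_eqVlt => /predU1P[<-|->]; last by rewrite sube0.
  by rewrite ltxx min_l.
- rewrite (_ : _ `&` _ = `]0, 1[%classic); last first.
    apply/seteqP; split => t; rewrite /= in_itv /=; first by case.
    by move=> ?; split => //; rewrite ltry.
  by rewrite lebesgue_measure_itv /= lte_fin ltr01 sube0 min_r// leey.
Qed.

End exponential_layer_cake.

(** * From level sets to the integral inequality *)

Section prekopa_leindler.
Context {R : realType}.
Local Notation lam := (@lebesgue_measure R).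

(** For each level t in ]0, 1[ the sets {F > t} and {G > t} are non-empty and their midpoints lie in
    {H > t}. The midpoint inequality is then integrated over t. *)
Lemma prekopa_leindler_normalized (F G : R -> R) (H : R -> \bar R) :
  measurable_fun setT F -> measurable_fun setT G -> measurable_fun setT H ->
  (forall u, 0 <= F u <= 1) -> (forall u, 0 <= G u <= 1) ->
  (forall u, 0 <= H u)%E ->
  (forall t, t < 1 -> exists u, t < F u) ->
  (forall t, t < 1 -> exists u, t < G u) ->
  (forall u v, (F u * G v)%:E <= H ((u + v) / 2)%R * H ((u + v) / 2)%R)%E ->
  (\int[lam]_u (F u)%:E + \int[lam]_u (G u)%:E <= 2%:E * \int[lam]_u H u)%E.
Proof.
move=> mF mG mH F01 G01 H0 F1 G1 FGH.
have mF' : measurable_fun setT (EFin \o F) by exact/measurable_EFinP.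
have mG' : measurable_fun setT (EFin \o G) by exact/measurable_EFinP.
have slam : sigma_finite setT lam by exact: sigma_finiteT.
pose I t := ((\1_(`]0%R, 1%R[%classic : set R) t)%:E : \bar R).
have mI : measurable_fun setT I.
  by apply/measurable_EFinP; apply: measurable_indic; exact: measurable_itv.
have I0 t : (0 <= I t)%E by rewrite lee_fin.
have E (K : R -> R) : measurable_fun setT K -> (forall u, 0 <= K u <= 1) ->
    (\int[lam]_u (K u)%:E =
     \int[lam]_t (I t * lam [set x | (t%:E < (K x)%:E)%E]))%E.
  move=> mK K01; rewrite -(@unit_layer_cake _ (EFin \o K)).
  - apply: eq_integral => u _ /=; rewrite -EFin_min min_l//.
    by have /andP[] := K01 u.
  - exact/measurable_EFinP.
  - by move=> u; rewrite lee_fin; have /andP[] := K01 u.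
have mlev (K : R -> \bar R) : measurable_fun setT K ->
    measurable_fun setT (fun t => (I t * lam [set x | (t%:E < K x)%E])%E).
  move=> mK; apply: emeasurable_funM => //.
  exact: (measurable_superlevel_measure slam mK (@measurable_id _ _ setT)).
rewrite (E F)// (E G)//.
(* Only levels below 1 are compared, so [H] is truncated at 1. *)
apply: (@le_trans _ _ (2%:E * \int[lam]_u mine (H u) 1)%E); last first.
  apply: lee_wpmul2l; first by rewrite lee_fin.
  apply: ge0_le_integral => //.
  - by move=> x _; rewrite le_min H0/= lee_fin.
  - by apply: measurable_mine => //; exact: measurable_cst.
  - by move=> x _; rewrite ge_min lexx.
rewrite unit_layer_cake//.
rewrite -ge0_integralD//; last 4 first.
- by move=> t _; rewrite mule_ge0 ?measure_ge0.
- exact: mlev.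
- by move=> t _; rewrite mule_ge0 ?measure_ge0.
- exact: mlev.
rewrite -ge0_integralZl//; last 2 first.
- exact: mlev.
- by move=> t _; rewrite mule_ge0 ?measure_ge0.
apply: ge0_le_integral => //.
- by move=> t _; rewrite adde_ge0 ?mule_ge0 ?measure_ge0.
- by apply: emeasurable_funD; exact: mlev.
- by apply: emeasurable_funM => //; exact: mlev.
move=> t _; rewrite -/(I t) -ge0_muleDr ?measure_ge0// muleCA.
have [t01|t01] := pselect (`]0%R, 1%R[%classic t); last first.
  by rewrite /I indicE memNset// !mul0e.
apply: lee_wpmul2l => //.
move: t01; rewrite /= in_itv /= => /andP[t0 t1].
have mset (K : R -> \bar R) : measurable_fun setT K ->
    measurable [set x | (t%:E < K x)%E].
  by move=> mK; exact: (measurable_superlevel mK (@measurable_id _ _ setT)).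
apply: brunn_minkowski_midpoint.
- by have [u tu] := F1 _ t1; exists u; rewrite /= lte_fin.
- by have [u tu] := G1 _ t1; exists u; rewrite /= lte_fin.
- exact: (mset (EFin \o F)).
- exact: (mset (EFin \o G)).
- exact: mset.
move=> u v; rewrite /= !lte_fin => tu tv; rewrite ltNge; apply/negP => Ht.
have := lee_pmul (H0 _) (H0 _) Ht Ht.
move/(le_trans (FGH u v)); rewrite -EFinM lee_fin leNgt => /negP; apply.
by rewrite ltr_pM// ltW.
Qed.

(** [F] and [G] are divided by their suprema [a] and [b], and [H] by the square root of [a * b]; the
    additive inequality then gives the product by the arithmetic-geometric mean inequality. *)
Lemma prekopa_leindler_bounded (F G : R -> R) (H : R -> \bar R) (M : R) :
  measurable_fun setT F -> measurable_fun setT G -> measurable_fun setT H ->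
  (forall u, 0 <= F u <= M) -> (forall u, 0 <= G u <= M) ->
  (forall u, 0 <= H u)%E ->
  (forall u v, (F u * G v)%:E <= H ((u + v) / 2)%R * H ((u + v) / 2)%R)%E ->
  (\int[lam]_u (F u)%:E * \int[lam]_u (G u)%:E <=
   (\int[lam]_u H u) * (\int[lam]_u H u))%E.
Proof.
move=> mF mG mH F0M G0M H0 FGH.
have H_ge0 : (0 <= \int[lam]_u H u)%E by exact: integral_ge0.
have supP (K : R -> R) : (forall u, 0 <= K u <= M) ->
    (\int[lam]_u (K u)%:E = 0)%E \/ exists a, [/\ 0 < a, forall u, 0 <= K u / a <= 1 &
      forall t, t < 1 -> exists u, t < K u / a].
  move=> K0M.
  have sK : has_sup (range K).
    by split; [exists (K 0), 0|exists M => _ [u _ <-]; have /andP[] := K0M u].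
  have Ks u : K u <= sup (range K) by apply: sup_upper_bound => //; exists u.
  have [s0|s0] := leP (sup (range K)) 0; [left|right].
    apply: integral0_eq => u _; congr EFin; apply/eqP; rewrite eq_le.
    by rewrite (le_trans (Ks u) s0); have /andP[] := K0M u.
  exists (sup (range K)); split => // [u|t t1].
    rewrite ler_pdivrMr// mul1r Ks andbT divr_ge0// ?(ltW s0)//.
    by have /andP[] := K0M u.
  have e0 : 0 < sup (range K) * (1 - t) by rewrite mulr_gt0// subr_gt0.
  have [_ [u _ <-]] := sup_adherent e0 sK.
  by rewrite mulrBr mulr1 subKr => h; exists u; rewrite ltr_pdivlMr// mulrC.
have [->|[a [a0 Fa Fsup]]] := supP F F0M; first by rewrite mul0e mule_ge0.
have [->|[b [b0 Gb Gsup]]] := supP G G0M; first by rewrite mule0 mule_ge0.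
pose c := Num.sqrt (a * b).
have ab0 : 0 < a * b by exact: mulr_gt0.
have c0 : 0 < c by rewrite sqrtr_gt0.
have c2 : c ^+ 2 = a * b by rewrite sqr_sqrtr// ltW.
have mdiv (K : R -> R) e : measurable_fun setT K ->
    measurable_fun setT (fun u => K u / e) by move=> mK; exact: measurable_funM.
have key := prekopa_leindler_normalized (mdiv F a mF) (mdiv G b mG)
  (emeasurable_funM (measurable_cst (c^-1)%:E) mH) Fa Gb _ Fsup Gsup _.
have intZ (K : R -> R) e : 0 < e -> measurable_fun setT K ->
    (forall u, 0 <= K u <= M) ->
    (\int[lam]_u (K u / e)%:E = e^-1%:E * \int[lam]_u (K u)%:E)%E.
  move=> e_gt0 mK K0; rewrite -ge0_integralZl//.
  - by apply: eq_integral => u _; rewrite mulrC.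
  - exact/measurable_EFinP.
  - by move=> u _; rewrite lee_fin; have /andP[] := K0 u.
  - by rewrite lee_fin invr_ge0 ltW.
move: key; rewrite (intZ F a)// (intZ G b)// ge0_integralZl//; last first.
  by rewrite lee_fin invr_ge0 ltW.
have ci0 : (0 <= (c^-1)%:E :> \bar R)%E by rewrite lee_fin invr_ge0 ltW.
move=> key; have {key} := key _ _.
have F_ge0 : (0 <= \int[lam]_u (F u)%:E)%E.
  by apply: integral_ge0 => u _; rewrite lee_fin; have /andP[] := F0M u.
have G_ge0 : (0 <= \int[lam]_u (G u)%:E)%E.
  by apply: integral_ge0 => u _; rewrite lee_fin; have /andP[] := G0M u.
move=> /(_ _)/wrap[].
  by move=> u; rewrite mule_ge0.
move=> /(_ _)/wrap[].
  move=> u v; rewrite muleACA -EFinM -invfM -expr2 c2 invfM.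
  rewrite (_ : F u / a * (G v / b) = a^-1 * b^-1 * (F u * G v)); last by ring.
  by rewrite EFinM; apply: lee_wpmul2l => //; rewrite lee_fin mulr_ge0// invr_ge0 ltW.
case: (\int[lam]_u H u)%E H_ge0 => [K||]// K0; last first.
  by move=> _; rewrite mulyy leey.
case: (\int[lam]_u (F u)%:E)%E F_ge0 => [I||]// I0; last first.
  rewrite mulry gtr0_sg ?invr_gt0// mul1e addye; last first.
    by rewrite gt_eqF// (lt_le_trans (ltNyr 0))// mule_ge0// lee_fin invr_ge0 ltW.
  by rewrite -!EFinM leye_eq.
case: (\int[lam]_u (G u)%:E)%E G_ge0 => [J||]// J0; last first.
  by rewrite mulry gtr0_sg ?invr_gt0// mul1e -!EFinM addey// leye_eq.
rewrite -!EFinM -EFinD !lee_fin => h.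
rewrite !lee_fin in I0 J0 K0.
set x := a^-1 * I in h; set y := b^-1 * J in h.
have xE : I = a * x by rewrite /x mulVKf// gt_eqF.
have yE : J = b * y by rewrite /y mulVKf// gt_eqF.
have x0 : 0 <= x by rewrite mulr_ge0// invr_ge0 ltW.
have y0 : 0 <= y by rewrite mulr_ge0// invr_ge0 ltW.
have h1 : c * (x + y) <= 2 * K.
  by move: h; rewrite mulrCA mulrC ler_pdivlMr// mulrC.
have h2 : (c * (x + y)) ^+ 2 <= (2 * K) ^+ 2.
  by rewrite ler_sqr ?nnegrE ?mulr_ge0 ?addr_ge0 ?(ltW c0).
(* The arithmetic-geometric mean inequality, in the form 4xy <= (x + y)^2. *)
have h3 : 0 <= a * b * (x - y) ^+ 2 by rewrite mulr_ge0 ?sqr_ge0// ltW.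
rewrite exprMn c2 in h2; rewrite xE yE; lra.
Qed.

(** Truncating [F] and [G] at [k] preserves the hypothesis with the same [H]; monotone convergence
    removes the truncation. *)
Lemma prekopa_leindler (F G H : R -> \bar R) :
  measurable_fun setT F -> measurable_fun setT G -> measurable_fun setT H ->
  (forall u, 0 <= F u)%E -> (forall u, 0 <= G u)%E -> (forall u, 0 <= H u)%E ->
  (forall u v, F u * G v <= H ((u + v) / 2)%R * H ((u + v) / 2)%R)%E ->
  (\int[lam]_u F u * \int[lam]_u G u <= \int[lam]_u H u * \int[lam]_u H u)%E.
Proof.
move=> mF mG mH F0 G0 H0 FGH.
pose tr (K : R -> \bar R) (k : nat) u := mine (K u) (k%:R%:E).
have tr_fin K k u : (0 <= K u)%E -> tr K k u \is a fin_num.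
  move=> K0; rewrite ge0_fin_numE; first by rewrite gt_min ltry orbT.
  by rewrite le_min K0 lee_fin ler0n.
have trE (K : R -> \bar R) k u : (0 <= K u)%E -> (fine (tr K k u))%:E = tr K k u.
  by move=> K0; rewrite fineK// tr_fin.
have tr0 (K : R -> \bar R) k u : (0 <= K u)%E -> (0 <= tr K k u)%E.
  by move=> K0; rewrite le_min K0 lee_fin ler0n.
have mtr (K : R -> \bar R) k : measurable_fun setT K -> measurable_fun setT (tr K k).
  by move=> mK; apply: measurable_mine => //; exact: measurable_cst.
have mftr (K : R -> \bar R) k : measurable_fun setT K ->
    measurable_fun setT (fun u => fine (tr K k u)).
  by move=> mK; apply: measurableT_comp => //; exact: mtr.
have cv (K : R -> \bar R) : measurable_fun setT K -> (forall u, 0 <= K u)%E ->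
    (\int[lam]_u tr K k u)%E @[k --> \oo] --> (\int[lam]_u K u)%E.
  move=> mK K0.
  have nd u : nondecreasing_seq (tr K ^~ u).
    by move=> i j ij; rewrite /tr le_min ge_min lexx /= ge_min lee_fin ler_nat ij orbT.
  have := @cvg_monotone_convergence _ _ _ lam setT measurableT (tr K).
  move=> /(_ (fun k => mtr K k mK) (fun k u _ => tr0 _ _ _ (K0 u)) (fun u _ => nd u)).
  congr (_ --> _); apply: eq_integral => u _.
  apply/cvg_lim => //; rewrite /tr.
  have := K0 u; case: (K u) => [r||]// _; last first.
    by under eq_cvg do rewrite min_r ?leey//; exact/cvgeryP/cvgr_idn.
  apply: cvg_near_cst; near=> k; rewrite min_l// lee_fin.
  by near: k; exact: nbhs_infty_ger.
have tri (K : R -> \bar R) k u : (tr K k u <= K u)%E by rewrite ge_min lexx.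
apply: (lee_mul_limit _ _ (cv F mF F0) (cv G mG G0)) => k.
- by apply: integral_ge0 => u _; exact: tr0.
- by apply: integral_ge0 => u _; exact: tr0.
have := @prekopa_leindler_bounded (fun u => fine (tr F k u)) (fun u => fine (tr G k u))
  H k%:R (mftr F k mF) (mftr G k mG) mH.
have b01 (K : R -> \bar R) u : (forall u, 0 <= K u)%E -> 0 <= fine (tr K k u) <= k%:R.
  move=> K0; rewrite -!lee_fin trE// tr0//=.
  by rewrite ge_min lexx orbT.
move=> /(_ (fun u => b01 F u F0) (fun u => b01 G u G0) H0).
have EI (K : R -> \bar R) : (forall u, 0 <= K u)%E ->
    (\int[lam]_u (fine (tr K k u))%:E = \int[lam]_u tr K k u)%E.
  by move=> K0; apply: eq_integral => u _; exact: trE.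
rewrite !EI//.
apply=> u v; rewrite EFinM !trE//; apply: le_trans (FGH u v).
by apply: lee_pmul => //; exact: tr0.
Unshelve. all: by end_near. Qed.

End prekopa_leindler.

(** * From sets to functions *)

Section superlevels.
Context {R : realType} {n : nat}.
Local Notation V := 'rV[R]_n.+2.
Local Notation mu := (rV_lebesgue R n.+2).
Local Notation lam := (@lebesgue_measure R).

Lemma rV_lebesgue_setT : mu [set: V] = +oo%E.
Proof.
have -> : [set: V] = [set x : V | forall i, [set: R] (x 0 i)] by apply/seteqP.
rewrite (@rV_lebesgue_box R n.+2 (fun=> setT))//.
have -> : lam setT = +oo%E.
  by rewrite -set_itvNyy lebesgue_measure_itv.
elim: n => [|m IH]; first by rewrite !big_ord_recl big_ord0 mule1 mulyy.
by rewrite big_ord_recl IH mulyy.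
Qed.

Lemma rV_lebesgue_set0 : mu [set 0] = 0%E.
Proof.
have -> : [set 0] = [set x : V | forall i, [set 0] (x 0 i)].
  apply/seteqP; split => x /=; first by move=> -> i; rewrite mxE.
  by move=> x0; apply/rowP => i; rewrite x0 mxE.
rewrite (@rV_lebesgue_box R n.+2 (fun=> [set 0]))//.
by rewrite big_ord_recl lebesgue_measure_set1 mul0e.
Qed.

Lemma measurable_neq0 : measurable [set z : V | z != 0].
Proof.
rewrite -[X in measurable X]setTI.
have := @measurable_sqr_norm R n.+2 measurableT _ (measurable_itv `]0, +oo[).
by congr measurable; apply/seteqP; split => x [_];
  rewrite /= in_itv /= andbT dotv_gt0.
Qed.

(** [D] stands for a superlevel set of [Omega], an initial interval of the half-line. With [r] its
    supremum, [A] and [B] satisfy the set inequality for [r], while [M] contains the punctured ball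
    of radius the square root of [r]. *)
Lemma sine_santalo_superlevels (A B M : set V) (D : set R) :
  measurable A -> measurable B -> measurable M ->
  (forall s t, 0 < s -> s <= t -> D t -> D s) ->
  (forall x y, A x -> B y -> 0 < sine_bracket x y -> D (sine_bracket x y)) ->
  (forall z, z != 0 -> D (dotv z z) -> M z) ->
  (mu A * mu B <= mu M * mu M)%E.
Proof.
move=> mA mB mM Ddown ABD DM.
pose Z : set V := [set 0].
have m0 : measurable Z.
  rewrite (_ : Z = ~` [set z : V | z != 0]).
    by apply: measurableC; exact: measurable_neq0.
  apply/seteqP; split => z /=; [by move=> ->; rewrite eqxx|].
  by move/negP; rewrite negbK => /eqP.
have muM (S : set V) : measurable S -> (forall z, S z -> z != 0 -> D (dotv z z)) ->
    (mu S <= mu M)%E.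
  move=> mS SD; apply: (@le_trans _ _ (mu (M `|` Z))).
    apply: le_measure; rewrite ?inE//; first exact: measurableU.
    move=> z Sz; have [->|z0] := eqVneq z 0; [by right|left].
    by apply: DM => //; exact: SD.
  apply: (le_trans (@measureU2 _ _ _ mu M Z mM m0)).
  have e0 : (mu Z <= 0)%E by rewrite rV_lebesgue_set0.
  by rewrite -[leRHS]adde0; exact: (leeD (lexx _) e0).
have [hD|hD] := pselect (has_ubound [set t | 0 < t /\ D t]); last first.
  have -> : mu M = +oo%E.
    apply/eqP; rewrite -leye_eq -rV_lebesgue_setT; apply: muM => // z _ z0.
    apply: contrapT => nD; apply: hD; exists (dotv z z) => t [t0 Dt].
    rewrite leNgt; apply/negP => zt; apply: nD; apply: Ddown Dt; rewrite ?dotv_gt0//.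
    exact: ltW.
  by rewrite mulyy leey.
(* Adding 0 keeps the set non-empty and makes [r] zero if [D] has no positive element. *)
pose r := sup ([set 0] `|` [set t | 0 < t /\ D t]).
have ubr : has_sup ([set 0] `|` [set t | 0 < t /\ D t]).
  split; first by exists 0; left.
  case: hD => b hb; exists (Num.max 0 b) => t [->|h]; first by rewrite le_max lexx.
  by rewrite le_max hb// orbT.
have r0 : 0 <= r by apply: sup_upper_bound => //; left.
have rAB x y : A x -> B y -> sine_bracket x y <= r.
  move=> Ax By; have := sine_bracket_ge0 x y; rewrite le_eqVlt => /predU1P[<-//|s0].
  by apply: sup_upper_bound => //; right; split => //; exact: ABD.
have Dr t : 0 < t -> t < r -> D t.
  move=> t0 tr; have e0 : 0 < r - t by rewrite subr_gt0.
  have [s + ] := sup_adherent e0 ubr.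
  rewrite subKr => -[->|[s0 Ds]] ts; first by move: (lt_trans t0 ts); rewrite ltxx.
  exact: Ddown (ltW ts) Ds.
set omega := mu (eball 1).
have omega_fin : omega \is a fin_num.
  by rewrite ge0_fin_numE ?measure_ge0// rV_lebesgue_eball_lty.
have AB : (mu A * mu B <= (r ^+ n.+2)%:E * (omega * omega))%E.
  have oo_fin : (omega * omega)%E \is a fin_num by rewrite fin_numM.
  (* The set inequality needs a radius above [r]; it decreases to [r] here. *)
  apply: (@cvge_to_ge R r^'+ _ R (fun rho => (rho ^+ n.+2)%:E * (omega * omega))%E).
    apply: cvgeZr => //; apply: cvg_EFin; first by near=> t.
    by apply: cvg_at_right_filter; exact: exprn_continuous.
  near=> rho; apply: (sine_santalo_sets r0) => //.
have [r00|r00] := eqVneq r 0.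
  move: AB; rewrite r00 expr0n /= mul0e => /le_trans; apply.
  by rewrite mule_ge0.
have rp : 0 < r by rewrite lt_neqAle eq_sym r00.
have sr0 : 0 < Num.sqrt r by rewrite sqrtr_gt0.
have rM : ((Num.sqrt r ^+ n.+2)%:E * omega <= mu M)%E.
  rewrite -rV_lebesgue_eball//; apply: muM; first exact: measurable_eball.
  move=> z; rewrite /eball /= sqr_sqrtr// => zr z0.
  by apply: Dr => //; rewrite dotv_gt0.
apply: (le_trans AB).
rewrite -{1}(sqr_sqrtr r0) expr2 exprMn EFinM muleACA.
by apply: lee_pmul => //; rewrite mule_ge0 ?measure_ge0// lee_fin exprn_ge0// ltW.
Unshelve. all: by end_near. Qed.

Lemma functional_sine_santalo
    (f g : V -> R) (Omega : R -> R)
    (f_ge0 : forall x, 0 <= f x) (mf : measurable_fun [set: V] f)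
    (g_ge0 : forall y, 0 <= g y) (mg : measurable_fun [set: V] g)
    (Omega_gt0 : forall t : R, 0 < t -> 0 < Omega t)
    (Omega_nincr : forall s t : R, 0 < s -> s <= t -> Omega t <= Omega s)
    (mOmega : measurable_fun (`]0, +oo[ : set R) Omega)
    (hfg : forall x y, 0 < sine_bracket x y ->
      f x * g y <= Omega (sine_bracket x y) ^+ 2) :
  (\int[mu]_x (f x)%:E * \int[mu]_y (g y)%:E <=
   (\int[mu]_(z in [set z : V | z != 0%R])
      (Omega (enorm z ^+ 2)%R)%:E) ^+ 2)%E.
Proof.
pose D : set V := [set z | z != 0].
(* [Omega] is constrained on positive reals only, so the integrand is replaced by 0 at the
   origin. *)
pose h := (fun z : V => Omega (dotv z z)) \_ D.
have mD : measurable D by exact: measurable_neq0.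
have mh : measurable_fun setT h.
  apply/(measurable_restrictT _ mD).
  apply: (@measurable_comp _ _ _ _ _ _ (`]0, +oo[ : set R)) => //.
  - by move=> _ [z z0 <-]; rewrite /= in_itv /= dotv_gt0 z0.
  - by apply: measurable_funTS; exact: measurable_sqr_norm.
have h0 z : 0 <= h z.
  rewrite /h patchE; case: ifPn => //; rewrite inE /D /= => z0.
  by rewrite ltW// Omega_gt0// dotv_gt0.
have -> : (\int[mu]_(z in [set z : V | z != 0%R]) (Omega (enorm z ^+ 2)%R)%:E =
    \int[mu]_z (h z)%:E)%E.
  rewrite integral_mkcond; apply: eq_integral => z _.
  by rewrite /h !patchE; case: ifP => // _; rewrite sqr_enorm.
have smu := @rV_lebesgue_sigma_finite R n.+2.
have mexp : measurable_fun setT (fun t : R => expR (- t)).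
  by apply: measurableT_comp => //; exact: measurable_funN.
have mlev (k : V -> R) : measurable_fun setT k -> measurable_fun setT
    (fun t : R => ((expR (- t))%:E * mu [set x | ((expR (- t))%:E < (k x)%:E)%E])%E).
  move=> /measurable_EFinP mk; apply: emeasurable_funM; first exact/measurable_EFinP.
  exact: (measurable_superlevel_measure smu mk mexp).
have mset (k : V -> R) (t : R) : measurable_fun setT k ->
    measurable [set x | ((expR (- t))%:E < (k x)%:E)%E].
  by move=> /measurable_EFinP mk; exact: (measurable_superlevel mk mexp).
have ge0 (t : R) (S : set V) : (0 <= (expR (- t))%:E * mu S)%E.
  by rewrite mule_ge0 ?measure_ge0// lee_fin expR_ge0.
rewrite (exponential_layer_cake smu mf f_ge0) (exponential_layer_cake smu mg g_ge0).
rewrite (exponential_layer_cake smu mh h0).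
apply: prekopa_leindler; [exact: mlev|exact: mlev|exact: mlev| | | |].
- by move=> ?; exact: ge0.
- by move=> ?; exact: ge0.
- by move=> ?; exact: ge0.
move=> u v; set w := (u + v) / 2.
(* The level at the midpoint is the geometric mean of the two levels, so the exponential weights
   cancel and an inequality between volumes remains. *)
have uvw : expR (- u) * expR (- v) = expR (- w) ^+ 2.
  by rewrite -expRD expr2 -expRD; congr expR; rewrite /w; lra.
rewrite muleACA [X in (_ <= X)%E]muleACA -!EFinM uvw -expr2.
apply: lee_wpmul2l; first by rewrite lee_fin sqr_ge0.
apply: (@sine_santalo_superlevels _ _ _ [set t | 0 < t /\ expR (- w) < Omega t]);
  try exact: mset.
- move=> s t s0 st [_ wt]; split => //; exact: lt_le_trans (Omega_nincr _ _ s0 st).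
- move=> x y; rewrite /= !lte_fin => ux vy s0; split => //.
  have O0 := Omega_gt0 _ s0.
  rewrite -ltr_sqr ?nnegrE ?expR_ge0 ?(ltW O0)//.
  apply: lt_le_trans (hfg _ _ s0); rewrite -uvw.
  by rewrite ltr_pM ?expR_ge0.
- move=> z z0 [_ wz]; rewrite /= lte_fin /h patchE mem_set//.
Qed.

End superlevels.

Theorem corollary1p5 (R : realType) (n : nat) (hn : (2 <= n)%N)
    (f g : 'rV[R]_n -> R) (Omega : R -> R)
    (f_ge0 : forall x, 0 <= f x) (mf : measurable_fun [set: 'rV[R]_n] f)
    (g_ge0 : forall y, 0 <= g y) (mg : measurable_fun [set: 'rV[R]_n] g)
    (Omega_gt0 : forall t : R, 0 < t -> 0 < Omega t)
    (Omega_nincr : forall s t : R, 0 < s -> s <= t -> Omega t <= Omega s)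
    (mOmega : measurable_fun (`]0, +oo[ : set R) Omega)
    (hfg : forall x y, 0 < sine_bracket x y -> f x * g y <= Omega (sine_bracket x y) ^+ 2) :
  (\int[rV_lebesgue R n]_x (f x)%:E * \int[rV_lebesgue R n]_y (g y)%:E <=
   (\int[rV_lebesgue R n]_(z in [set z : 'rV[R]_n | z != 0%R])
      (Omega (enorm z ^+ 2)%R)%:E) ^+ 2)%E.
Proof.
case: n hn f g f_ge0 mf g_ge0 mg hfg => [|[|n]]// _ f g f_ge0 mf g_ge0 mg hfg.
exact: (functional_sine_santalo f_ge0 mf g_ge0 mg Omega_gt0 Omega_nincr mOmega hfg).
Qed.
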